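(* Let $m,n_1,\ldots,n_m$ be positive integers, let $0<q<\infty$, and let $Y$ be a Banach space over $\mathbb{K}$ satisfying the following condition: there exist $C_1,C_2>0$ and a real number $p\ge 1$ such that for every $n\in\mathbb{N}$ there are $y_1,\ldots,y_n\in Y$ with $\|y_j\|\ge C_1$ for every $j$ and $$\Big\|\sum_{j=1}^n a_j y_j\Big\|\le C_2\Big(\sum_{j=1}^n |a_j|^p\Big)^{1/p}\quad\text{for all } a_1,\ldots,a_n\in\mathbb{K}.$$ For each $k=1,\ldots,m$ let $X_k$ be an infinite dimensional Banach space over $\mathbb{K}$ with a normalized unconditional Schauder basis $(x_n^{(k)})_{n\in\mathbb{N}}$. If $q<p$ and $$\mathcal{P}_{as(q;1)}(^{n_1}X_1,\ldots,{}^{n_m}X_m;Y)=\mathcal{P}(^{n_1}X_1,\ldots,{}^{n_m}X_m;Y),$$ then $\eta\le q$, where $\eta=\eta\big(n_1,\ldots,n_m,X_1,\ldots,X_m,(x_n^{(1)})_{n},\ldots,(x_n^{(m)})_{n}\big)$.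
   Context: The scalar field $\mathbb{K}$ is $\mathbb{R}$ or $\mathbb{C}$. A mapping $P:X_1\times\cdots\times X_m\to Y$ is an $(n_1,\ldots,n_m)$-homogeneous polynomial (multipolynomial) if it is an $n_k$-homogeneous polynomial in the $k$-th variable, for each $k$, when the other variables are fixed. $\mathcal{P}(^{n_1}X_1,\ldots,{}^{n_m}X_m;Y)$ is the space of all continuous such mappings, normed by $\|P\|=\sup\{\|P(x_1,\ldots,x_m)\|:\max_k\|x_k\|\le 1\}$. For $0<p<\infty$, $\ell_p(Y)$ is the set of sequences $(y_j)$ in $Y$ with $\sum_j\|y_j\|^p<\infty$. For a Banach space $X$, $\ell_1^w(X)$ is the set of sequences $(x_j)$ in $X$ such that $\sum_j|\varphi(x_j)|<\infty$ for every continuous linear functional $\varphi$ on $X$. For $0<q<\infty$, a continuous $(n_1,\ldots,n_m)$-homogeneous polynomial $P$ is absolutely $(q;1)$-summing if $\big(P(x_j^{(1)},\ldots,x_j^{(m)})\big)_{j=1}^\infty\in\ell_q(Y)$ whenever $(x_j^{(k)})_{j=1}^\infty\in\ell_1^w(X_k)$ for $k=1,\ldots,m$. The set of all such $P$ is denoted $\mathcal{P}_{as(q;1)}(^{n_1}X_1,\ldots,{}^{n_m}X_m;Y)$. For infinite dimensional Banach spaces $X_k$ with normalized unconditional Schauder bases $(x_n^{(k)})_{n\in\mathbb{N}}$, $k=1,\ldots,m$, the number $\eta$ is the infimum of all $t>0$ such that $\Big(\prod_{k=1}^m (a_j^{(k)})^{n_k}\Big)_{j=1}^\infty\in\ell_t$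 whenever $x_k=\sum_{j=1}^\infty a_j^{(k)}x_j^{(k)}\in X_k$ for $k=1,\ldots,m$ (with $\inf\emptyset=\infty$). *)

(* Defs.v *)
From mathcomp Require Import all_boot.
From Stdlib Require Import Reals.
From Coquelicot Require Import Coquelicot.

Set Implicit Arguments.
Unset Strict Implicit.
Unset Printing Implicit Defensive.

Local Open Scope R_scope.

Definition R_or_C (K : AbsRing) : Prop := K = R_AbsRing \/ K = C_AbsRing.

(* Stdlib has [Rpower 0 p = 1], since [ln 0 = 0] there; [rpow 0 p = 0]. *)
Definition rpow (x p : R) : R := if Rlt_dec 0 x then Rpower x p else 0.

Definition ell (K : AbsRing) (Y : NormedModule K) (p : R) (y : nat -> Y) : Prop :=
  ex_series (fun j => rpow (norm (y j)) p).

(* [is_linear] includes boundedness, and [AbsRing_NormedModule K] is the scalar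
   field normed by its absolute value, so [phi] is a continuous functional. *)
Definition ell1w (K : AbsRing) (X : CompleteNormedModule K) (x : nat -> X) : Prop :=
  forall phi : X -> AbsRing_NormedModule K,
    is_linear phi -> ex_series (fun j => abs (phi (x j))).

Definition infinite_dimensional (K : AbsRing) (E : ModuleSpace K) : Prop :=
  forall (N : nat) (v : nat -> E), exists x : E,
    forall a : nat -> K, x <> sum_n_m (fun j => scal (a j) (v j)) 1 N.

Definition schauder_basis (K : AbsRing) (X : CompleteNormedModule K)
    (e : nat -> X) : Prop :=
  forall x : X, exists! a : nat -> K, is_series (fun j => scal (a j) (e j)) x.

Definition unconditionally_convergent (K : AbsRing) (X : CompleteNormedModule K)
    (x : nat -> X) : Prop :=
  forall s : nat -> nat, bijective s -> ex_series (fun j => x (s j)).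

Definition unconditional_basis (K : AbsRing) (X : CompleteNormedModule K)
    (e : nat -> X) : Prop :=
  schauder_basis e /\
  forall (x : X) (a : nat -> K), is_series (fun j => scal (a j) (e j)) x ->
    unconditionally_convergent (fun j => scal (a j) (e j)).

Definition normalized (K : AbsRing) (X : CompleteNormedModule K)
    (e : nat -> X) : Prop :=
  forall j, norm (e j) = 1.

(* [dfwith x u] is the family [x] with its entry at the index of [u]
   replaced by [u]. *)
Definition multilinear (K : AbsRing) (E F : ModuleSpace K) (n : nat)
    (A : ('I_n -> E) -> F) : Prop :=
  forall (x : 'I_n -> E) (i : 'I_n) (c : K) (u v : E),
    let x_with (w : E) := @dfwith _ (fun _ => E) x i w in
    A (x_with (plus (scal c u) v)) = plus (scal c (A (x_with u))) (A (x_with v)).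

Definition homogeneous_poly (K : AbsRing) (E F : ModuleSpace K) (n : nat)
    (Q : E -> F) : Prop :=
  exists A : ('I_n -> E) -> F, multilinear A /\ forall x, Q x = A (fun _ => x).

Section Multipolynomials.

Variables (K : AbsRing) (m : nat) (n : 'I_m -> nat).
Variables (X : 'I_m -> CompleteNormedModule K) (Y : CompleteNormedModule K).

Definition multipoly (P : (forall k, X k) -> Y) : Prop :=
  forall (x : forall k, X k) (k : 'I_m),
    homogeneous_poly (n k) (fun u : X k => P (dfwith x u)).

(* Joint continuity for the norm [max_k ||x_k||]. *)
Definition multi_continuous (P : (forall k, X k) -> Y) : Prop :=
  forall (x : forall k, X k) (eps : posreal), exists delta : posreal,
    forall y : forall k, X k,
      (forall k, norm (minus (y k) (x k)) < delta) ->
      norm (minus (P y) (P x)) < eps.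

Definition continuous_multipoly (P : (forall k, X k) -> Y) : Prop :=
  multipoly P /\ multi_continuous P.

Definition as_summing (q : R) (P : (forall k, X k) -> Y) : Prop :=
  continuous_multipoly P /\
  forall x : forall k, nat -> X k,
    (forall k, ell1w (x k)) -> ell q (fun j => P (fun k => x k j)).

Definition eta (e : forall k, nat -> X k) : Rbar :=
  Glb_Rbar (fun t => 0 < t /\
    forall (x : forall k, X k) (a : 'I_m -> nat -> K),
      (forall k, is_series (fun j => scal (a k j) (e k j)) (x k)) ->
      @ell K (AbsRing_NormedModule K) t
        (fun j => \big[mult/one]_(k < m) pow_n (a k j) (n k))).

End Multipolynomials.

(* Main.v *)
(* Write b_j(x) for the product over k of the n_k-th powers of the j-th
   coordinates of x_k. If (b_j(x)) is not in l_q for some x, there are consecutive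
   finite blocks of indices on which the supremum s_i over the unit balls of
   sum |b_j|^q is as large as we please. Coordinates are uniformly bounded, so
   |b_j|^p <= C |b_j|^q and the polynomial sum_(block i) b_j y_j has norm
   O(s_i^(1/p)); hence P = sum_i 2^-i s_i^(-1/p) sum_(block i) b_j y_j is
   continuous. Gluing near-maximizers of the s_i, damped by 2^-i, into one point x
   and testing P on the weakly summable sequences (coord_j(x_k) e_j)_j, the block i
   contributes about c^i s_i^(1 - q/p) to the sum of the q-th powers of the norms,
   which is at least 1 when s_i is large because q < p. So b(x) is in l_q for
   every x. *)
From HB Require Import structures.
Require Import Defs.
From mathcomp Require Import all_boot zify.
From Stdlib Require Import Reals Lra ClassicalEpsilon FunctionalExtensionality.
From Coquelicot Require Import Coquelicot.

Set Implicit Arguments.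
Unset Strict Implicit.
Unset Printing Implicit Defensive.

Local Open Scope R_scope.

(** The uniform bound on coordinates is where completeness of the spaces X_k enters: by Baire's
    theorem the points whose partial sums obey one common bound are dense in some ball, and
    successive approximation passes from dense to all. Unconditionality enters in the weak
    summability of the test sequences: every rearrangement of an expansion converges, so its image
    under a functional converges absolutely by Riemann's rearrangement argument. The vectors y_j
    given for different n are unrelated, so each block has a family of its own and only the weights
    tie the blocks together. What block i loses to the weight 2^-i and to the damping of the glued
    point depends on i alone; hence the level that s_i has to exceed can be fixed before the block
    is chosen. Homogeneity in the k-th variable is established on the coefficients: the n_k equal
    factors of b_j become coordinates of n_k separate vectors. The series over the blocks must then
    converge for these polarized coefficients as well, so its convergence is studied for arbitrary
    scalar sequences. *)

Lemma half_pow_gt0 i : 0 < (/ 2) ^ i.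
Proof. apply: pow_lt; lra. Qed.

Lemma half_pow_small c eps : 0 < eps ->
  exists N, forall i, (N <= i)%nat -> c * (/ 2) ^ i < eps.
Proof.
move=> he; have h2 : Rabs (/ 2) < 1 by rewrite Rabs_pos_eq; lra.
have hc := Rle_abs c; have hc0 := Rabs_pos c.
have hpos : 0 < eps / (Rabs c + 1) by apply: Rdiv_lt_0_compat; lra.
have [N hN] := pow_lt_1_zero _ h2 _ hpos.
exists N => i hi; have hp := half_pow_gt0 i.
have := hN i ltac:(lia); rewrite Rabs_pos_eq; last lra.
move=> /Rlt_div_r h; have := h ltac:(lra); nra.
Qed.

(** * Scalars and convergence in normed modules *)


Section ScalarField.
Variables (K : AbsRing) (hK : R_or_C K).

Lemma scalar_multC (x y : K) : mult x y = mult y x.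
Proof.
case: hK => E; move: x y; rewrite E => x y.
  exact: Rmult_comm.
exact: Cmult_comm.
Qed.

Lemma scalar_abs_mult (x y : K) : abs (mult x y) = abs x * abs y.
Proof.
case: hK => E; move: x y; rewrite E => x y.
  exact: Rabs_mult.
exact: Cmod_mult.
Qed.

(** [io] is the inclusion of the reals; through it real factors act on vectors without separating
    the two fields. *)
Lemma scalar_real_embedding : exists io : R -> K,
  (forall r, abs (io r) = Rabs r) /\
  (forall r s, mult (io r) (io s) = io (r * s)) /\ io 1 = one.
Proof.
case: hK => ->; first by exists id.
exists RtoC; split; first exact: Cmod_R.
by split=> // r s; rewrite RtoC_mult.
Qed.

Lemma scalar_inverse (x : K) : x <> zero -> exists y, mult y x = one.
Proof.
case: hK => E; move: x; rewrite E => x hx.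
  by exists (/ x); exact: Rinv_l.
by exists (Cinv x); exact: Cinv_l.
Qed.

(** Real and imaginary part, the latter being zero over the reals; they reduce absolute convergence
    of scalar series to real series. *)
Lemma scalar_real_parts : exists r1 r2 : K -> R,
  [/\ forall x y, r1 (plus x y) = r1 x + r1 y,
      forall x y, r2 (plus x y) = r2 x + r2 y,
      forall x, Rabs (r1 x) <= abs x,
      forall x, Rabs (r2 x) <= abs x &
      forall x, abs x <= Rabs (r1 x) + Rabs (r2 x)].
Proof.
case: hK => ->.
  exists id, (fun=> 0); split=> //= x; rewrite ?Rabs_R0.
  - by move=> _; rewrite Rplus_0_r.
  - exact: Rle_refl.
  - exact: Rabs_pos.
  - by rewrite Rplus_0_r; exact: Rle_refl.
exists (@fst R R), (@snd R R); split=> // x.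
- have := Rmax_Cmod x; exact: Rle_trans (Rmax_l _ _).
- have := Rmax_Cmod x; exact: Rle_trans (Rmax_r _ _).
rewrite {1}(_ : x = plus (RtoC (fst x)) (mult Ci (RtoC (snd x)))).
  apply: Rle_trans (abs_triangle _ _) _.
  rewrite /abs /= Cmod_R Cmod_mult Cmod_R.
  rewrite (_ : Cmod Ci = 1); last first.
    rewrite /Cmod /Ci /=.
    rewrite (_ : _ + _ = 1); [exact: sqrt_1 | ring].
  by rewrite Rmult_1_l; exact: Rle_refl.
case: x => a b; rewrite /plus /mult /= /Cplus /Cmult /Ci /=.
by f_equal; ring.
Qed.

(** The axiom [norm_scal] is an inequality; applied to the inverse of [a] it yields the converse. *)
Lemma norm_scal_eq (X : NormedModule K) (a : K) (x : X) :
  norm (scal a x) = abs a * norm x.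
Proof.
case: (excluded_middle_informative (a = zero)) => [->|ha].
  by rewrite abs_zero scal_zero_l norm_zero Rmult_0_l.
apply: Rle_antisym; first exact: norm_scal.
have [b hb] := scalar_inverse ha.
have hab : abs b * abs a = 1 by rewrite -scalar_abs_mult hb abs_one.
have := @norm_scal K X b (scal a x).
rewrite scal_assoc hb scal_one => h.
have ha0 := abs_ge_0 a; have := Rmult_le_compat_l _ _ _ ha0 h.
rewrite -Rmult_assoc (Rmult_comm (abs a) (abs b)) hab; lra.
Qed.

End ScalarField.

Section Modules.
Variables (K : AbsRing) (V : NormedModule K).
Implicit Types x y z : V.

Lemma norm_minus_sym x y : norm (minus x y) = norm (minus y x).
Proof. by rewrite -norm_opp opp_minus. Qed.

Lemma norm_minus_triangle y x z :
  norm (minus x z) <= norm (minus x y) + norm (minus y z).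
Proof. rewrite (minus_trans y); exact: norm_triangle. Qed.

Lemma plus_plus_swap (x y z t : V) :
  plus (plus x y) (plus z t) = plus (plus x z) (plus y t).
Proof.
by rewrite -!plus_assoc (plus_assoc y) (plus_comm y z) -(plus_assoc z).
Qed.

Lemma minus_plus_plus (x y z t : V) :
  minus (plus x y) (plus z t) = plus (minus x z) (minus y t).
Proof. by rewrite /minus opp_plus plus_plus_swap. Qed.

Lemma minus_minus_minus (x y z t : V) :
  minus (minus x y) (minus z t) = minus (minus x z) (minus y t).
Proof.
rewrite {2 4}/minus minus_plus_plus; congr plus.
by rewrite /minus opp_opp opp_plus opp_opp.
Qed.

Lemma minus_plus_r (x y : V) : plus (minus x y) y = x.
Proof. by rewrite /minus -plus_assoc plus_opp_l plus_zero_r. Qed.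

Lemma minus_plus_l (x y : V) : minus (plus x y) y = x.
Proof. by rewrite /minus -plus_assoc plus_opp_r plus_zero_r. Qed.

Lemma scal_minus_r (a : K) x y : scal a (minus x y) = minus (scal a x) (scal a y).
Proof. by rewrite /minus scal_distr_l scal_opp_r. Qed.

Lemma scal_minus_l (a b : K) x : scal (minus a b) x = minus (scal a x) (scal b x).
Proof. by rewrite /minus scal_distr_r scal_opp_l. Qed.

Lemma norm_minus_eq0 x y : norm (minus x y) <= 0 -> x = y.
Proof.
move=> h; have h0 : norm (minus x y) = 0 by apply: Rle_antisym => //; exact: norm_ge_0.
by rewrite -(minus_plus_r x y) (norm_eq_zero _ h0) plus_zero_l.
Qed.

Lemma sum_n_m_minus (u v : nat -> V) a b :
  minus (sum_n_m u a b) (sum_n_m v a b) = sum_n_m (fun j => minus (u j) (v j)) a b.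
Proof.
rewrite /minus -(scal_opp_one (sum_n_m v a b)) -sum_n_m_scal_l -sum_n_m_plus.
by apply: sum_n_m_ext => j; rewrite scal_opp_one.
Qed.

Definition tends_to (u : nat -> V) (l : V) : Prop :=
  forall eps, 0 < eps -> exists N, forall n, (N <= n)%nat ->
    norm (minus (u n) l) < eps.

Lemma filterlim_tends_to (u : nat -> V) (l : V) :
  filterlim u eventually (locally l) <-> tends_to u l.
Proof.
rewrite filterlim_locally_ball_norm; split=> h.
  move=> eps he; have [N hN] := h (mkposreal _ he).
  by exists N => n hn; apply: hN; lia.
move=> eps; have [N hN] := h eps (cond_pos eps).
by exists N => n hn; apply: hN; lia.
Qed.

Lemma is_series_tends_to (a : nat -> V) (l : V) :
  is_series a l <-> tends_to (sum_n a) l.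
Proof. exact: filterlim_tends_to. Qed.

Lemma tends_to_unique (u : nat -> V) (l l' : V) :
  tends_to u l -> tends_to u l' -> l = l'.
Proof.
move=> h h'; apply: norm_minus_eq0; apply: le_epsilon => eps he.
have he2 : 0 < eps / 2 by lra.
have [N hN] := h _ he2; have [N' hN'] := h' _ he2.
have := hN (N + N')%nat ltac:(lia); have := hN' (N + N')%nat ltac:(lia).
have := norm_minus_triangle (u (N + N')%nat) l l'.
rewrite (norm_minus_sym l (u _)); lra.
Qed.

Lemma tends_to_plus (u v : nat -> V) (l l' : V) :
  tends_to u l -> tends_to v l' -> tends_to (fun i => plus (u i) (v i)) (plus l l').
Proof.
move=> h h' eps he.
have he2 : 0 < eps / 2 by lra.
have [N hN] := h _ he2; have [N' hN'] := h' _ he2.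
exists (N + N')%nat => n hn.
have h1 : (N <= n)%nat by lia.
have h1' : (N' <= n)%nat by lia.
rewrite minus_plus_plus; apply: Rle_lt_trans (norm_triangle _ _) _.
have := hN n h1; have := hN' n h1'; lra.
Qed.

Lemma tends_to_scal (a : K) (u : nat -> V) (l : V) :
  tends_to u l -> tends_to (fun i => scal a (u i)) (scal a l).
Proof.
move=> h eps he; have ha := abs_ge_0 a.
have he2 : 0 < eps / (abs a + 1) by apply: Rdiv_lt_0_compat; lra.
have [N hN] := h _ he2.
exists N => n hn; rewrite -scal_minus_r.
apply: Rle_lt_trans (norm_scal _ _) _.
have h1 := hN n hn; have h0 := norm_ge_0 (minus (u n) l).
apply: (@Rlt_le_trans _ ((abs a + 1) * (eps / (abs a + 1)))); first by nra.
by apply: Req_le; field; lra.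
Qed.

Lemma tends_to_norm_le (u : nat -> V) (l y : V) (c : R) (N : nat) :
  tends_to u l -> (forall n, (N <= n)%nat -> norm (minus (u n) y) <= c) ->
  norm (minus l y) <= c.
Proof.
move=> h hc; apply: le_epsilon => eps he.
have [N' hN'] := h _ he.
have := hN' (N + N')%nat ltac:(lia); have := hc (N + N')%nat ltac:(lia).
have := norm_minus_triangle (u (N + N')%nat) l y.
rewrite (norm_minus_sym l (u _)); lra.
Qed.

Lemma tends_to_squeeze (u : nat -> V) (l : V) (c : R) :
  (forall i, norm (minus (u i) l) <= c * (/ 2) ^ i) -> tends_to u l.
Proof.
move=> h eps /(half_pow_small c) [N hN].
by exists N => n /hN; apply: Rle_lt_trans (h n).
Qed.

(* A form of completeness with an explicit rate; unlike [CompleteNormedModule]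
   it makes sense for the scalar field seen as a normed module. *)
Definition geometrically_complete : Prop :=
  forall (u : nat -> V) (rho : nat -> R),
    (forall i, norm (minus (u i.+1) (u i)) <= rho i) ->
    (forall i, rho i.+1 <= rho i / 2) ->
    exists l, forall i, norm (minus (u i) l) <= 2 * rho i.

End Modules.

Lemma halving_bound (rho : nat -> R) :
  (forall i, rho i.+1 <= rho i / 2) -> forall i, rho i <= rho 0%nat * (/ 2) ^ i.
Proof.
move=> h; elim=> [|i IH] /=; first lra.
have := h i; lra.
Qed.

Lemma complete_geometrically (K : AbsRing) (X : CompleteNormedModule K) :
  geometrically_complete X.
Proof.
move=> u rho hu hrho.
have rho0 i : 0 <= rho i by apply: Rle_trans (norm_ge_0 _) (hu i).
(* A telescoping bound: since [rho] halves, each step satisfies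
   [rho i <= 2 * rho i - 2 * rho i.+1]. *)
have hd i d : norm (minus (u (i + d)%nat) (u i)) <= 2 * rho i - 2 * rho (i + d)%nat.
  elim: d => [|d IH].
    by rewrite addn0 minus_eq_zero norm_zero; lra.
  have := norm_minus_triangle (u (i + d)%nat) (u (i + d.+1)%nat) (u i).
  rewrite addnS; have := hu (i + d)%nat; have := hrho (i + d)%nat; lra.
have hd' i n : (i <= n)%nat -> norm (minus (u n) (u i)) <= 2 * rho i.
  move=> hin; rewrite -(subnKC hin); have := hd i (n - i)%nat.
  have := rho0 (i + (n - i))%nat; lra.
have hsmall : forall eps, 0 < eps -> exists N, rho N < eps.
  move=> eps /(half_pow_small (rho 0%nat)) [N hN].
  by exists N; apply: Rle_lt_trans (halving_bound hrho N) (hN N (leqnn N)).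
have [l hl] : exists l : X, filterlim u eventually (locally l).
  apply/filterlim_locally_cauchy => eps.
  have he4 : 0 < eps / 4 by have := cond_pos eps; lra.
  have [N hN] := hsmall _ he4.
  exists (fun n => (N <= n)%nat); split; first by exists N => n hn; lia.
  move=> a b ha hb; apply: norm_compat1.
  apply: Rle_lt_trans (norm_minus_triangle (u N) _ _) _.
  rewrite (norm_minus_sym (u N)).
  have := hd' _ _ ha; have := hd' _ _ hb; lra.
move/filterlim_tends_to: hl => hl.
exists l => i; rewrite norm_minus_sym.
by apply: tends_to_norm_le hl (hd' i).
Qed.

Lemma scalar_geometrically_complete (K : AbsRing) (hK : R_or_C K) :
  geometrically_complete (AbsRing_NormedModule K).
Proof.
case: hK => ->.
  exact: (@complete_geometrically _ R_CompleteNormedModule).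
exact: (@complete_geometrically _ C_CompleteNormedModule).
Qed.

(** * Schauder bases: the partial sums are uniformly bounded *)


(** Otherwise every ball contains a smaller one disjoint from [A M]. Doing this for each [M] in turn
    gives balls whose centres converge to a point lying in no [A M]. *)
Lemma baire (K : AbsRing) (X : NormedModule K) (hX : geometrically_complete X)
  (A : nat -> X -> Prop) :
  (forall x, exists M, A M x) ->
  exists M x0 r, 0 < r /\ forall x : X, norm (minus x x0) < r ->
    forall eps, 0 < eps -> exists z, norm (minus x z) < eps /\ A M z.
Proof.
move=> hA; apply: NNPP => hn.
have step (M : nat) (s : X * R) : exists s' : X * R, 0 < s.2 ->
    [/\ norm (minus s'.1 s.1) <= s.2 / 4, 0 < s'.2, s'.2 <= s.2 / 2 &
        forall z, A M z -> s'.2 <= norm (minus s'.1 z)].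
  case: (Rlt_dec 0 s.2) => hs; last by exists s.
  apply: NNPP => hs'; apply: hn; exists M, s.1, (s.2 / 4); split; first lra.
  move=> x hx eps he; apply: NNPP => hz; apply: hs'.
  exists (x, Rmin eps (s.2 / 2)) => _ /=; split.
  - lra.
  - apply: Rmin_glb_lt; lra.
  - exact: Rmin_r.
  move=> z hAz; apply: Rle_trans (Rmin_l _ _) _.
  by apply: Rnot_lt_le => hlt; apply: hz; exists z.
pose f M s := proj1_sig (constructive_indefinite_description _ (step M s)).
have fP M s : 0 < s.2 -> [/\ norm (minus (f M s).1 s.1) <= s.2 / 4, 0 < (f M s).2,
    (f M s).2 <= s.2 / 2 & forall z, A M z -> (f M s).2 <= norm (minus (f M s).1 z)].
  exact: (proj2_sig (constructive_indefinite_description _ (step M s))).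
pose S := fix S (i : nat) : X * R := if i is j.+1 then f j (S j) else (zero, 1).
have SE i : S i.+1 = f i (S i) by [].
have Spos i : 0 < (S i).2.
  elim: i => [|i IH] /=; first lra.
  by have [] := fP i (S i) IH.
have h1 i : norm (minus (S i.+1).1 (S i).1) <= (S i).2 / 4.
  by have [] := fP i (S i) (Spos i).
have h2 i : (S i.+1).2 / 4 <= (S i).2 / 4 / 2.
  by have [_ _ h _] := fP i (S i) (Spos i); rewrite SE; lra.
(* Each centre moves by at most a quarter of the current radius, so [l] is within half the radius of
   every centre and stays inside all the balls. *)
have [l hl] := hX _ _ h1 h2.
have [M hM] := hA l.
have [_ _ _] := fP M (S M) (Spos M); rewrite -SE => h.
have := Rle_trans _ _ _ (h l hM) (hl M.+1); have := Spos M.+1; lra.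
Qed.

Section Coordinates.
Variables (K : AbsRing) (hK : R_or_C K) (X : NormedModule K).
Hypothesis hX : geometrically_complete X.
Variables (e : nat -> X).
Hypothesis he : forall x : X, exists! a : nat -> K, is_series (fun j => scal (a j) (e j)) x.

Definition coord (x : X) : nat -> K :=
  epsilon (inhabits (fun=> zero)) (fun a => is_series (fun j => scal (a j) (e j)) x).

Definition psum (x : X) (N : nat) : X := sum_n (fun j => scal (coord x j) (e j)) N.

Lemma coord_is_series x : is_series (fun j => scal (coord x j) (e j)) x.
Proof.
have [a [ha _]] := he x; rewrite /coord.
by apply: (epsilon_spec _ (fun a => is_series (fun j => scal (a j) (e j)) x)); exists a.
Qed.

Lemma psum_tends_to x : tends_to (psum x) x.
Proof. apply/is_series_tends_to; exact: coord_is_series. Qed.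

Lemma coord_unique x a : tends_to (sum_n (fun j => scal (a j) (e j))) x -> coord x = a.
Proof.
move=> /is_series_tends_to ha; have [b [_ hb]] := he x.
by rewrite -(hb _ ha) -(hb _ (@coord_is_series x)).
Qed.

Lemma coord_plus x y : coord (plus x y) = fun j => plus (coord x j) (coord y j).
Proof.
apply: coord_unique => eps heps.
have [N hN] := tends_to_plus (@psum_tends_to x) (@psum_tends_to y) heps.
exists N => n /hN; rewrite /psum -sum_n_plus.
by under sum_n_ext => j do rewrite -scal_distr_r.
Qed.

Lemma coord_scal c x : coord (scal c x) = fun j => mult c (coord x j).
Proof.
apply: coord_unique => eps heps.
have [N hN] := tends_to_scal c (@psum_tends_to x) heps.
exists N => n /hN; rewrite /psum -sum_n_scal_l.
by under sum_n_ext => j do rewrite scal_assoc.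
Qed.

Lemma coord_minus x y : coord (minus x y) = fun j => minus (coord x j) (coord y j).
Proof.
rewrite /minus coord_plus -scal_opp_one coord_scal.
apply: functional_extensionality => j.
by rewrite -opp_mult_l mult_one_l.
Qed.

Lemma coord_finite_sum (a : nat -> K) lo hi j :
  coord (sum_n_m (fun l => scal (a l) (e l)) lo hi) j =
  if (lo <= j <= hi)%nat then a j else zero.
Proof.
set b := fun l => if (lo <= l <= hi)%nat then a l else zero.
rewrite (_ : coord _ = b) //; apply: coord_unique => eps heps.
exists hi => n hn; rewrite (_ : minus _ _ = zero) ?norm_zero //.
rewrite (_ : sum_n _ n = sum_n_m (fun l => scal (a l) (e l)) lo hi).
  by rewrite minus_eq_zero.
case: (ltnP hi lo) => h.
  rewrite [RHS]sum_n_m_zero; last by lia.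
  rewrite /sum_n (sum_n_m_ext _ (fun=> zero)) ?sum_n_m_const_zero // => l.
  rewrite /b (_ : (lo <= l <= hi)%nat = false) ?scal_zero_l //; by lia.
have hz (u v : nat) : (v < lo \/ hi < u)%nat ->
    sum_n_m (fun l => scal (b l) (e l)) u v = zero.
  move=> huv; rewrite (sum_n_m_ext_loc _ (fun=> zero)) ?sum_n_m_const_zero // => l hl.
  rewrite /b (_ : (lo <= l <= hi)%nat = false) ?scal_zero_l //; by lia.
rewrite /sum_n (@sum_n_m_Chasles _ _ 0 hi n); [|lia|lia].
rewrite (hz hi.+1 n); last by lia.
rewrite plus_zero_r.
have -> : sum_n_m (fun l => scal (b l) (e l)) 0 hi =
    sum_n_m (fun l => scal (b l) (e l)) lo hi.
  case: lo h @b hz => [//|lo] h b hz.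
  rewrite (@sum_n_m_Chasles _ _ 0 lo hi); [|lia|lia].
  by rewrite (hz 0%nat lo) ?plus_zero_l //; lia.
apply: sum_n_m_ext_loc => l hl.
by rewrite /b (_ : (lo <= l <= hi)%nat) //; lia.
Qed.

Lemma coord_basis_scal (c : K) l j :
  coord (scal c (e l)) j = if j == l then c else zero.
Proof.
rewrite -(sum_n_n (fun l => scal c (e l))) (coord_finite_sum (fun=> c)).
by rewrite (_ : (l <= j <= l)%nat = (j == l)) //; lia.
Qed.

Lemma psum_plus x y N : psum (plus x y) N = plus (psum x N) (psum y N).
Proof.
rewrite /psum -sum_n_plus coord_plus; apply: sum_n_ext => j.
by rewrite scal_distr_r.
Qed.

Lemma psum_scal c x N : psum (scal c x) N = scal c (psum x N).
Proof.
rewrite /psum -sum_n_scal_l coord_scal; apply: sum_n_ext => j.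
by rewrite scal_assoc.
Qed.

Lemma psum_minus x y N : psum (minus x y) N = minus (psum x N) (psum y N).
Proof.
by rewrite /minus -(scal_opp_one y) -(scal_opp_one (psum y N)) psum_plus psum_scal.
Qed.

Hypothesis he1 : forall j, norm (e j) = 1.

(** A coordinate times its basis vector is the difference of two consecutive partial sums, and the
    basis is normalized. *)
Lemma coord_psum_le x M j :
  (forall N, norm (psum x N) <= M) -> abs (coord x j) <= 2 * M.
Proof.
move=> h; have M0 : 0 <= M by apply: Rle_trans (norm_ge_0 _) (h 0%nat).
rewrite (_ : abs _ = norm (scal (coord x j) (e j))); last first.
  by rewrite (norm_scal_eq hK) he1 Rmult_1_r.
case: j => [|j]; first by have := h 0%nat; rewrite /psum sum_O; lra.
rewrite (_ : scal _ _ = minus (psum x j.+1) (psum x j)).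
  apply: Rle_trans (norm_triangle _ _) _; rewrite norm_opp.
  by have := h j; have := h j.+1; lra.
by rewrite /psum sum_Sn plus_comm minus_plus_l.
Qed.

(** The bound is a natural number so that the sets of points sharing a bound form a countable cover,
    as [baire] requires. *)
Lemma psum_bounded x : exists M : nat, forall N, norm (psum x N) <= INR M.
Proof.
have [N0 hN0] := @psum_tends_to x _ Rlt_0_1.
have [B hB] : exists B, forall N, (N <= N0)%nat -> norm (psum x N) <= B.
  elim: N0 {hN0} => [|N0 [B hB]].
    by exists (norm (psum x 0)) => N; rewrite leqn0 => /eqP ->; exact: Rle_refl.
  exists (Rmax B (norm (psum x N0.+1))) => N hN.
  case: (ltngtP N N0.+1) => [h||->]; last exact: Rmax_r.
    by apply: Rle_trans (Rmax_l _ _); apply: hB.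
  by lia.
have [M hM] := INR_unbounded (Rmax B (norm x + 1)).
exists M => N; apply: Rlt_le; apply: Rle_lt_trans hM.
case: (leqP N N0) => h; first by apply: Rle_trans (Rmax_l _ _); exact: hB.
apply: Rle_trans (Rmax_r _ _).
have := hN0 N (ltnW h); have := norm_triangle (minus (psum x N) x) x.
rewrite minus_plus_r; lra.
Qed.

(* One step of the successive approximation in the open mapping argument. *)
Lemma psum_approx : exists c, 0 < c /\ forall x, exists z,
  norm (minus x z) <= norm x / 2 /\ forall N, norm (psum z N) <= c * norm x.
Proof.
have [M [x0 [r [hr hd]]]] := @baire K X hX
  (fun M x => forall N, norm (psum x N) <= INR M) psum_bounded.
have hM := pos_INR M.
(* Subtracting approximants of [plus x x0] and of [x0] moves the ball to the origin, at the price of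
   doubling the bound. *)
have hd' (x : X) eps : norm x < r -> 0 < eps ->
    exists z, norm (minus x z) < eps /\ forall N, norm (psum z N) <= 2 * INR M.
  move=> hx heps; have he2 : 0 < eps / 2 by lra.
  have hx0 : norm (minus (plus x x0) x0) < r by rewrite minus_plus_l.
  have h00 : norm (minus x0 x0) < r by rewrite minus_eq_zero norm_zero.
  have [z1 [h1 b1]] := hd _ hx0 _ he2; have [z2 [h2 b2]] := hd _ h00 _ he2.
  exists (minus z1 z2); split.
    rewrite -(minus_plus_l x x0) minus_minus_minus.
    apply: Rle_lt_trans (norm_triangle _ _) _; rewrite norm_opp; lra.
  move=> N; rewrite psum_minus; apply: Rle_trans (norm_triangle _ _) _.
  rewrite norm_opp; have := b1 N; have := b2 N; lra.
have [io [ioa [iom io1]]] := scalar_real_embedding hK.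
(* Undoing the scaling by [t] turns [2 * INR M] into [4 * INR M / r * norm x]; the summand 1 keeps
   the constant positive when [INR M] is 0. *)
exists (4 * INR M / r + 1); split.
  have : 0 <= 4 * INR M / r by apply: Rdiv_le_0_compat; lra.
  lra.
move=> x; case: (Req_dec (norm x) 0) => hx0.
  exists zero; rewrite hx0 minus_zero_r hx0; split; first lra.
  move=> N; rewrite -(scal_zero_l (zero : X)) psum_scal scal_zero_l norm_zero; lra.
have hx : 0 < norm x by have := norm_ge_0 x; lra.
(* Scales [x] to norm [r / 2], inside the ball; the accuracy [r / 4] requested below is half of that
   norm. *)
set t := r / (2 * norm x).
have ht : 0 < t by apply: Rdiv_lt_0_compat; lra.
have htx : t * norm x = r / 2 by rewrite /t; field; lra.
have it : 0 < / t by exact: Rinv_0_lt_compat.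
have hitt : / t * t = 1 by apply: Rinv_l; lra.
have hn s (y : X) : 0 < s -> norm (scal (io s) y) = s * norm y.
  by move=> hs; rewrite (norm_scal_eq hK) ioa Rabs_pos_eq //; lra.
have [||z [hz bz]] := hd' (scal (io t) x) (r / 4); try by rewrite ?hn; lra.
have hxs : x = scal (io (/ t)) (scal (io t) x).
  by rewrite scal_assoc iom hitt io1 scal_one.
exists (scal (io (/ t)) z); split.
  rewrite {1}hxs -scal_minus_r hn //.
  apply: (@Rle_trans _ (/ t * (r / 4))); first by apply: Rmult_le_compat_l; lra.
  by apply: Req_le; rewrite /t; field; lra.
move=> N; rewrite psum_scal hn //.
apply: (@Rle_trans _ (/ t * (2 * INR M))); first by apply: Rmult_le_compat_l; [lra|exact: bz].
rewrite (_ : / t * _ = 4 * INR M / r * norm x); first by nra.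
by rewrite /t; field; lra.
Qed.

(** Iterating [psum_approx] gives [u i] tending to [x], with increments whose partial sums are
    bounded by [rho i] uniformly in [N]. The coordinates of [u i] therefore converge, and their
    limits [a j] turn out to be the coordinates of [x]; continuity of the coordinate functionals is
    a consequence and not an ingredient. *)
Lemma basis_constant : exists B, 0 < B /\ forall x N, norm (psum x N) <= B * norm x.
Proof.
have [c [hc happ]] := psum_approx.
exists (2 * c); split; first lra; move=> x.
pose g y := proj1_sig (constructive_indefinite_description _ (happ y)).
have gP y : norm (minus y (g y)) <= norm y / 2 /\
    forall N, norm (psum (g y) N) <= c * norm y.
  exact: (proj2_sig (constructive_indefinite_description _ (happ y))).
pose u := fix u i : X := if i is j.+1 then plus (u j) (g (minus x (u j))) else zero.
have hu i : norm (minus x (u i)) <= norm x * (/ 2) ^ i.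
  elim: i => [|i IH] /=; first by rewrite minus_zero_r; lra.
  have [h _] := gP (minus x (u i)).
  rewrite (_ : minus x (plus _ _) = minus (minus x (u i)) (g (minus x (u i)))); first lra.
  by rewrite /minus opp_plus plus_assoc.
have hdu i : minus (u i.+1) (u i) = g (minus x (u i)).
  by rewrite /= plus_comm minus_plus_l.
have hx0 := norm_ge_0 x.
pose rho i := c * norm x * (/ 2) ^ i.
have hp i : 0 < (/ 2) ^ i by apply: pow_lt; lra.
have hbd i N : norm (psum (minus (u i.+1) (u i)) N) <= rho i.
  rewrite hdu; have [_ h] := gP (minus x (u i)); apply: Rle_trans (h N) _.
  by rewrite /rho Rmult_assoc; apply: Rmult_le_compat_l (hu i); lra.
have hrho i : rho i.+1 <= rho i / 2 by rewrite /rho /=; lra.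
have hS N : exists l, forall i, norm (minus (psum (u i) N) l) <= 2 * rho i.
  apply: hX => i //.
  by rewrite -psum_minus; exact: hbd.
have hC j : exists a : K, forall i, abs (minus (coord (u i) j) a) <= 4 * rho i.
  have [||a ha] := (@scalar_geometrically_complete K hK (fun i => coord (u i) j)
      (fun i => 2 * rho i)).
  - move=> i; have := coord_psum_le j (hbd i); rewrite coord_minus; exact.
  - move=> i; have := hrho i; lra.
  - exists a => i; apply: Rle_trans (ha i) _; lra.
pose a j := proj1_sig (constructive_indefinite_description _ (hC j)).
have aP j i : abs (minus (coord (u i) j) (a j)) <= 4 * rho i.
  exact: (proj2_sig (constructive_indefinite_description _ (hC j))).
pose s N := sum_n (fun j => scal (a j) (e j)) N.
(* For fixed [N], [psum (u i) N] has a limit by completeness, with a rate free of [N]; computed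
   coordinate by coordinate, this limit is [s N]. *)
have hsl N i : norm (minus (psum (u i) N) (s N)) <= 2 * rho i.
  have [l hl] := hS N; rewrite (_ : s N = l) //.
  apply: (@tends_to_unique _ _ (fun i => psum (u i) N)); last first.
    apply: (@tends_to_squeeze _ _ _ _ (2 * (c * norm x))) => k.
    by apply: Rle_trans (hl k) _; rewrite /rho; lra.
  apply: (@tends_to_squeeze _ _ _ _ (INR N.+1 * (4 * (c * norm x)))) => k.
  rewrite /psum /s /sum_n sum_n_m_minus.
  apply: Rle_trans (norm_sum_n_m _ _ _) _.
  apply: (@Rle_trans _ (sum_n_m (fun=> 4 * rho k) 0 N)).
    apply: sum_n_m_le => j; rewrite -scal_minus_l (norm_scal_eq hK) he1 Rmult_1_r.
    exact: aP.
  by rewrite sum_n_m_const PeanoNat.Nat.sub_0_r /rho; lra.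
(* As the rate is uniform in [N], [I] is fixed before [n] grows. The constant [2 * c + 1] adds the
   distance from [s n] to [psum (u I) n] and that from [u I] to [x]. *)
have hx : tends_to s x.
  move=> eps heps.
  have he4 : 0 < eps / 2 by lra.
  have [I hI] : exists I, (2 * c + 1) * norm x * (/ 2) ^ I < eps / 2.
    by have [I hI] := half_pow_small ((2 * c + 1) * norm x) he4; exists I; exact: hI.
  have [N hN] := @psum_tends_to (u I) _ he4.
  exists N => n hn.
  have h1 := hN n hn; have h2 := hsl n I; have h3 := hu I.
  have := norm_minus_triangle (psum (u I) n) (s n) x.
  have := norm_minus_triangle (u I) (psum (u I) n) x.
  rewrite (norm_minus_sym (s n) (psum _ n)) (norm_minus_sym (u I) x).
  move: h2 hI; rewrite /rho; lra.
move=> N; rewrite /psum (coord_unique hx) -/(s N).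
(* [u 0] is zero, so the rate at rank 0 bounds [s N] itself. *)
have := hsl N 0%nat; rewrite /rho /= (_ : psum zero N = zero).
  by rewrite /minus plus_zero_l norm_opp; lra.
by rewrite -(scal_zero_l (zero : X)) psum_scal !scal_zero_l.
Qed.

End Coordinates.

(** * Unconditional convergence and weak summability *)


HB.instance Definition _ := Monoid.isComLaw.Build R 0 Rplus
  (fun x y z => esym (Rplus_assoc x y z)) Rplus_comm Rplus_0_l.
HB.instance Definition _ := Monoid.isComLaw.Build R 1 Rmult
  (fun x y z => esym (Rmult_assoc x y z)) Rmult_comm Rmult_1_l.

Lemma sum_n_m_big (f : nat -> R) a b :
  sum_n_m f a b = \big[Rplus/0]_(j <- seq.iota a (b.+1 - a)) f j.
Proof.
case: (leqP a b) => h; last first.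
  rewrite sum_n_m_zero; last by lia.
  by rewrite (_ : (b.+1 - a)%nat = 0%nat) ?big_nil //; lia.
rewrite -(subnKC h); elim: (b - a)%nat => [|d IH].
  by rewrite addn0 sum_n_n subSn // subnn big_seq1.
rewrite addnS sum_n_Sm; last by lia.
rewrite IH (_ : ((a + d).+2 - a)%nat = ((a + d).+1 - a) + 1)%nat; last by lia.
rewrite iotaD big_cat big_seq1 /plus /=; do 3 f_equal; lia.
Qed.

Lemma ex_series_bounded (v : nat -> R) M :
  (forall j, 0 <= v j) -> (forall N, sum_n v N <= M) -> ex_series v.
Proof.
move=> hv hM.
have [l hl] : ex_finite_lim_seq (sum_n v).
  apply: (@ex_finite_lim_seq_incr _ M) => // N.
  by rewrite sum_Sn; have := hv N.+1; rewrite /plus /=; lra.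
by exists l.
Qed.

Lemma sum_n_m_nonneg (v : nat -> R) a b :
  (forall j, 0 <= v j) -> 0 <= sum_n_m v a b.
Proof.
by move=> hv; rewrite sum_n_m_big; apply: big_ind => *; rewrite //=; [lra|exact: Rplus_le_le_0_compat].
Qed.

Lemma divergent_tail (v : nat -> R) :
  (forall j, 0 <= v j) -> ~ ex_series v ->
  forall lo L, exists hi, (lo <= hi)%nat /\ L <= sum_n_m v lo hi.
Proof.
move=> hv hn lo L; apply: NNPP => hno; apply: hn.
apply: (@ex_series_bounded _ (sum_n v lo + Rmax 0 L)) => // N.
have h0 := Rmax_l 0 L; have h1 := Rmax_r 0 L.
case: (leqP N lo) => h.
  rewrite /sum_n (@sum_n_m_Chasles _ v 0 N lo); [|lia|lia].
  have := sum_n_m_nonneg N.+1 lo hv; rewrite /plus /=; lra.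
rewrite /sum_n (@sum_n_m_Chasles _ v 0 lo N); [|lia|lia].
rewrite /plus /=; apply: Rplus_le_compat_l; apply: Rle_trans h1.
apply: (@Rle_trans _ (sum_n_m v lo N)).
  rewrite (@sum_Sn_m _ v lo N); last by lia.
  by have := hv lo; rewrite /plus /=; lra.
apply: Rnot_lt_le => hlt; apply: hno; exists N; split; [lia | lra].
Qed.

(** If the positive parts diverged, the indices could be cut into consecutive blocks on which these
    parts sum to at least 1. Listing in each block the indices of positive terms before the others
    defines a bijection, and the rearranged series then has stretches of sum at least 1 arbitrarily
    far out, against the Cauchy criterion. *)
Lemma riemann_positive_part (u : nat -> R) :
  (forall s : nat -> nat, bijective s -> ex_series (fun j => u (s j))) ->
  ex_series (fun j => Rmax 0 (u j)).
Proof.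
move=> hs; apply: NNPP => hn.
have hv j : 0 <= Rmax 0 (u j) by exact: Rmax_l.
have htail := divergent_tail hv hn.
pose hi lo := proj1_sig (constructive_indefinite_description _ (htail lo 1)).
have hiP lo : (lo <= hi lo)%nat /\ 1 <= sum_n_m (fun j => Rmax 0 (u j)) lo (hi lo).
  exact: (proj2_sig (constructive_indefinite_description _ (htail lo 1))).
pose N := fix N i := if i is j.+1 then (hi (N j)).+1 else 0%nat.
have NS i : N i.+1 = (hi (N i)).+1 by [].
pose pos j : bool := Rlt_dec 0 (u j).
pose blk i := seq.iota (N i) (N i.+1 - N i).
pose l := fix l i := if i is j.+1
  then l j ++ (filter pos (blk j) ++ filter (predC pos) (blk j)) else [::].
have lS i : l i.+1 = l i ++ (filter pos (blk i) ++ filter (predC pos) (blk i)) by [].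
have Nlt i : (N i < N i.+1)%nat by rewrite NS; have [h _] := hiP (N i).
have Nge i : (i <= N i)%nat.
  by elim: i => // i IH; apply: leq_ltn_trans IH (Nlt i).
have lperm i : perm_eq (l i) (seq.iota 0 (N i)).
  elim: i => // i IH; rewrite lS.
  rewrite -(subnKC (ltnW (Nlt i))) iotaD add0n; apply: perm_cat => //.
  exact/permPl/perm_filterC.
have lsize i : size (l i) = N i by rewrite (perm_size (lperm i)) size_iota.
have luniq i : uniq (l i) by rewrite (perm_uniq (lperm i)) iota_uniq.
have lmem i v : (v \in l i) = (v < N i)%nat by rewrite (perm_mem (lperm i)) mem_iota.
have lnth i d j : (j < N i)%nat -> nth 0%nat (l (i + d)%nat) j = nth 0%nat (l i) j.
  move=> hj; elim: d => [|d IH]; first by rewrite addn0.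
  rewrite addnS lS nth_cat lsize IH (_ : (j < N (i + d))%nat) //.
  apply: leq_trans hj _; elim: d {IH} => [|d IH]; first by rewrite addn0.
  by rewrite addnS; apply: leq_trans IH (ltnW (Nlt _)).
(* [l j.+1] has [N j.+1 > j] entries, so the default of [nth] is never reached; later lists only
   extend this one. *)
pose s j := nth 0%nat (l j.+1) j.
have sE i j : (j < N i)%nat -> s j = nth 0%nat (l i) j.
  move=> hj; rewrite /s; case: (leqP i j.+1) => h.
    by rewrite -(subnKC h) lnth.
  by rewrite -(subnKC (ltnW h)) [RHS]lnth.
have sinj : injective s.
  move=> j k; set I := maxn j.+1 k.+1.
  have hj : (j < N I)%nat by apply: leq_trans (Nge _); rewrite leq_max leqnn.
  have hk : (k < N I)%nat by apply: leq_trans (Nge _); rewrite leq_max leqnn orbT.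
  rewrite (sE I j hj) (sE I k hk) => /eqP.
  by rewrite nth_uniq ?lsize // => /eqP.
have sbij : bijective s.
  pose g v := index v (l v.+1).
  have gK : cancel g s.
    move=> v; have hm : v \in l v.+1 by rewrite lmem.
    by rewrite (sE v.+1) ?nth_index // -lsize index_mem.
  by exists g => // j; apply: sinj; rewrite gK.
have [M hM] := @Cauchy_ex_series _ R_CompleteNormedModule _ (hs s sbij) (mkposreal 1 Rlt_0_1).
set p := filter pos (blk M).
have hsum : 1 <= \big[Rplus/0]_(j <- p) u j.
  have [_] := hiP (N M); rewrite sum_n_m_big -NS -/(blk M) => h.
  apply: Rle_trans h _; apply: Req_le; rewrite /p big_filter [RHS]big_mkcond.
  apply: eq_bigr => j _; rewrite /pos; case: (Rlt_dec 0 (u j)) => h /=.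
    by apply: Rmax_right; lra.
  by apply: Rmax_left; lra.
(* Makes [N M + (size p).-1] the position of the last positive term of the block. *)
have hsz : (0 < size p)%nat.
  by case: (p) hsum => //; rewrite big_nil; lra.
have := hM (N M) (N M + (size p).-1)%nat.
have hMN := Nge M.
have -> : sum_n_m (fun j => u (s j)) (N M) (N M + (size p).-1) =
    \big[Rplus/0]_(j <- p) u j.
  rewrite sum_n_m_big [RHS](big_nth 0%nat).
  rewrite (_ : (_ - _)%nat = size p); last by lia.
  rewrite (_ : seq.iota _ _ = map (addn (N M)) (seq.iota 0 (size p))); last first.
    by rewrite -iotaDl addn0.
  rewrite big_map /index_iota subn0.
  rewrite big_seq [RHS]big_seq; apply: eq_bigr => r; rewrite mem_iota add0n => /= hr.
  rewrite (sE M.+1); last first.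
    rewrite -(subnKC (ltnW (Nlt M))) ltn_add2l; apply: leq_trans hr _.
    by rewrite /p size_filter; apply: leq_trans (count_size _ _) _; rewrite size_iota.
  by rewrite lS nth_cat lsize ltnNge leq_addr /= addnC addnK nth_cat hr.
move=> h; have {}h : Rabs (\big[Rplus/0]_(j <- p) u j) < 1 by apply: h; lia.
have := Rle_abs (\big[Rplus/0]_(j <- p) u j); lra.
Qed.

Lemma riemann_abs (u : nat -> R) :
  (forall s : nat -> nat, bijective s -> ex_series (fun j => u (s j))) ->
  ex_series (fun j => Rabs (u j)).
Proof.
move=> hs.
have h1 := riemann_positive_part hs.
have h2 : ex_series (fun j => Rmax 0 (- u j)).
  apply: riemann_positive_part => s /hs; exact: ex_series_opp.
apply: ex_series_ext (ex_series_plus _ _ h1 h2) => j.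
rewrite /plus /= /Rmax /Rabs.
case: Rcase_abs => ?; case: Rle_dec => ?; case: Rle_dec => ?; lra.
Qed.

(** A bounded functional maps each convergent rearrangement to a convergent one; for the real and
    the imaginary part of the image this forces absolute convergence. *)
Lemma ell1w_unconditional (K : AbsRing) (hK : R_or_C K) (X : CompleteNormedModule K)
  (x : nat -> X) : unconditionally_convergent x -> ell1w x.
Proof.
move=> hx phi hphi.
have [r1 [r2 [a1 a2 b1 b2 b12]]] := scalar_real_parts hK.
have [M [hM hphiM]] := linear_norm _ hphi.
have main (r : K -> R) : (forall x y, r (plus x y) = r x + r y) ->
    (forall x, Rabs (r x) <= abs x) -> ex_series (fun j => Rabs (r (phi (x j)))).
  move=> ra rb; apply: riemann_abs => s hs.
  have r0 : r zero = 0 by have := ra zero zero; rewrite plus_zero_l; lra.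
  apply: (@ex_series_Cauchy _ R_CompleteNormedModule) => eps.
  have he : 0 < eps / M by apply: Rdiv_lt_0_compat => //; exact: cond_pos.
  have [N hN] := @Cauchy_ex_series _ _ _ (hx s hs) (mkposreal _ he).
  exists N => a b ha hb.
  have -> : sum_n_m (fun j => r (phi (x (s j)))) a b =
      r (phi (sum_n_m (fun j => x (s j)) a b)).
    have h0 : phi zero = zero.
      by rewrite -(scal_zero_l (zero : X)) linear_scal // scal_zero_l.
    case: (leqP a b) => hab; last by rewrite !sum_n_m_zero ?h0 ?r0 //; lia.
    rewrite -(subnKC hab); elim: (b - a)%nat => [|d IH].
      by rewrite addn0 !sum_n_n.
    rewrite addnS !sum_n_Sm; try lia.
    by rewrite linear_plus // ra IH.
  apply: Rle_lt_trans (rb _) _; apply: Rle_lt_trans (hphiM _) _.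
  have h := hN a b ha hb; apply: (@Rlt_le_trans _ (M * (eps / M))).
    exact: Rmult_lt_compat_l.
  by apply: Req_le; field; lra.
apply: (@ex_series_le R_AbsRing R_CompleteNormedModule _
    (fun j => Rabs (r1 (phi (x j))) + Rabs (r2 (phi (x j))))).
  move=> j; change (Rabs (abs (phi (x j))) <= Rabs (r1 (phi (x j))) + Rabs (r2 (phi (x j)))).
  rewrite Rabs_pos_eq; [exact: b12 | exact: abs_ge_0].
by apply: (@ex_series_plus R_AbsRing R_NormedModule); apply: main.
Qed.

(** * Real powers and finite products *)


Lemma rpowE x p : 0 < x -> rpow x p = Rpower x p.
Proof. by move=> hx; rewrite /rpow; case: Rlt_dec. Qed.

Lemma rpow0 p : rpow 0 p = 0.
Proof. by rewrite /rpow; case: (Rlt_dec 0 0) => [h|//]; lra. Qed.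

Lemma rpow_ge0 x p : 0 <= rpow x p.
Proof.
rewrite /rpow; case: (Rlt_dec 0 x) => h; last exact: Rle_refl.
by apply: Rlt_le; exact: exp_pos.
Qed.

Lemma rpow_gt0 x p : 0 < x -> 0 < rpow x p.
Proof. by move=> hx; rewrite rpowE //; exact: exp_pos. Qed.

Lemma rpow_mult x y p : 0 <= x -> 0 <= y -> rpow (x * y) p = rpow x p * rpow y p.
Proof.
move=> [hx|<-]; last by rewrite Rmult_0_l rpow0 Rmult_0_l.
move=> [hy|<-]; last by rewrite Rmult_0_r rpow0 Rmult_0_r.
by rewrite !rpowE // ?Rpower_mult_distr //; exact: Rmult_lt_0_compat.
Qed.

Lemma rpow_le x y p : 0 <= p -> 0 <= x <= y -> rpow x p <= rpow y p.
Proof.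
move=> hp [[hx|<-] hy]; last by rewrite rpow0; exact: rpow_ge0.
rewrite !rpowE; try lra; apply: Rle_Rpower_l; lra.
Qed.

Lemma rpow_add x p q : 0 <= x -> rpow x (p + q) = rpow x p * rpow x q.
Proof.
move=> [hx|<-]; last by rewrite !rpow0 Rmult_0_l.
by rewrite !rpowE // Rpower_plus.
Qed.

Lemma rpow_rpow x p q : 0 <= x -> rpow (rpow x p) q = rpow x (p * q).
Proof.
move=> [hx|<-]; last by rewrite !rpow0.
by rewrite (rpowE p hx) (rpowE _ hx) rpowE ?Rpower_mult //; exact: exp_pos.
Qed.

Lemma rpow_opp x p : 0 < x -> rpow x (- p) * rpow x p = 1.
Proof.
move=> hx; rewrite -rpow_add ?Rplus_opp_l; last lra.
by rewrite rpowE // Rpower_O.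
Qed.

Lemma sum_n_m_le_loc (a b : nat -> R) lo hi :
  (forall j, (lo <= j <= hi)%nat -> a j <= b j) -> sum_n_m a lo hi <= sum_n_m b lo hi.
Proof.
move=> h; rewrite !sum_n_m_big big_seq [X in _ <= X]big_seq.
apply: (big_ind2 (fun x y : R => x <= y)); first exact: Rle_refl.
  by move=> *; exact: Rplus_le_compat.
by move=> j; rewrite mem_iota => hj; apply: h; lia.
Qed.

Lemma sum_n_m_Rmult_l c (a : nat -> R) lo hi :
  sum_n_m (fun j => c * a j) lo hi = c * sum_n_m a lo hi.
Proof. exact: (@sum_n_m_mult_l R_Ring). Qed.

Lemma bounded_family (I : finType) (f : I -> R) : exists M, 0 < M /\ forall i, f i <= M.
Proof.
have [M [hM h]] : exists M, 0 < M /\ forall i, i \in enum I -> f i <= M.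
  elim: (enum I) => [|a r [M [hM h]]]; first by exists 1; split=> //; lra.
  exists (M + Rabs (f a)); have h0 := Rabs_pos (f a); split; first lra.
  move=> i; rewrite inE => /orP [/eqP ->|/h]; last lra.
  have := Rle_abs (f a); lra.
by exists M; split=> // i; apply: h; rewrite mem_enum.
Qed.

Lemma family_argmax n (f : 'I_n -> R) : (0 < n)%nat -> exists i, forall j, f j <= f i.
Proof.
case: n f => // n f _.
have [i hi] : exists i, forall j, j \in enum 'I_n.+1 -> f j <= f i.
  elim: (enum 'I_n.+1) => [|a r [i h]]; first by exists ord0.
  case: (Rle_dec (f a) (f i)) => hai.
    by exists i => j; rewrite inE => /orP [/eqP ->|/h].
  exists a => j; rewrite inE => /orP [/eqP ->|/h]; [exact: Rle_refl|lra].
by exists i => j; apply: hi; rewrite mem_enum.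
Qed.

Lemma prod_gt0 (I : finType) (f : I -> R) :
  (forall i, 0 < f i) -> 0 < \big[Rmult/1]_i f i.
Proof.
by move=> h; apply: big_ind => // [|x y]; [lra | exact: Rmult_lt_0_compat].
Qed.

Lemma prod_le (I : finType) (f g : I -> R) :
  (forall i, 0 <= f i <= g i) -> \big[Rmult/1]_i f i <= \big[Rmult/1]_i g i.
Proof.
move=> h; suff : 0 <= \big[Rmult/1]_i f i <= \big[Rmult/1]_i g i by case.
apply: (big_ind2 (fun x y : R => 0 <= x <= y)) => [|x x' y y' hx hy|i _] //; first lra.
by split; [apply: Rmult_le_pos | apply: Rmult_le_compat]; lra.
Qed.

Section ScalarProducts.
Variables (K : AbsRing) (hK : R_or_C K).

Let mulC := scalar_multC hK.
(** Commutativity depends on [hK], so the law is packed locally instead of being declared for all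
    [AbsRing]. *)
Let mul_com : SemiGroup.com_law K :=
  HB.pack (@mult K) (SemiGroup.isComLaw.Build K mult (@mult_assoc K) mulC).

Lemma scalar_bigD1 (I : finType) (i : I) (f : I -> K) :
  \big[mult/one]_k f k = mult (f i) (\big[mult/one]_(k | k != i) f k).
Proof. exact: (@bigD1 K mul_com one I i xpredT f isT). Qed.

Lemma scalar_abs_pow (x : K) n : abs (pow_n x n) = abs x ^ n.
Proof.
elim: n => [|n IH] /=; first exact: abs_one.
by rewrite (scalar_abs_mult hK) IH.
Qed.

Lemma abs_big (I : finType) (P : pred I) (f : I -> K) :
  abs (\big[mult/one]_(k | P k) f k) = \big[Rmult/1]_(k | P k) abs (f k).
Proof. exact: (big_morph _ (scalar_abs_mult hK) abs_one). Qed.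

Lemma big_const_pow_n n (c : K) : \big[mult/one]_(i < n) c = pow_n c n.
Proof. by rewrite big_const_ord; elim: n => //= n ->. Qed.

Lemma big_linear_entry (I : finType) (i : I) (f g h : I -> K) c :
  (forall k, k != i -> f k = g k) -> (forall k, k != i -> f k = h k) ->
  f i = plus (mult c (g i)) (h i) ->
  \big[mult/one]_k f k = plus (mult c (\big[mult/one]_k g k)) (\big[mult/one]_k h k).
Proof.
move=> hg hh hi; rewrite !(scalar_bigD1 i) hi mult_distr_r -mult_assoc.
by congr (plus (mult _ (mult _ _)) (mult _ _)); apply: eq_bigr.
Qed.

End ScalarProducts.

(** * Series over separated blocks *)


Lemma sum_n_m_single (G : AbelianMonoid) (f : nat -> G) a b j :
  (forall l, l != j -> f l = zero) ->
  sum_n_m f a b = if (a <= j <= b)%nat then f j else zero.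
Proof.
move=> hz.
have hz' a' b' : (j < a' \/ b' < j)%nat -> sum_n_m f a' b' = zero.
  move=> h; rewrite (sum_n_m_ext_loc _ (fun=> zero)) ?sum_n_m_const_zero // => l hl.
  by rewrite hz //; apply/eqP; lia.
case: ifP => h; last by apply: hz'; lia.
rewrite (@sum_n_m_Chasles _ _ a j b); [|lia|lia].
rewrite (hz' j.+1 b) ?plus_zero_r; last by lia.
case: j {hz} h hz' => [|j] h hz'; first by rewrite (_ : a = 0%nat) ?sum_n_n //; lia.
rewrite sum_n_Sm; last by lia.
by rewrite hz' ?plus_zero_l //; lia.
Qed.

Definition separated_blocks (lo hi : nat -> nat) : Prop :=
  forall i, (lo i <= hi i)%nat /\ (hi i < lo i.+1)%nat.

Lemma separated_blocks_lt lo hi i i' : separated_blocks lo hi -> (i < i')%nat ->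
  (hi i < lo i')%nat.
Proof.
move=> h hi'; rewrite -(subnKC hi'); elim: (i' - i.+1)%nat => [|d IH].
  by rewrite addn0; case: (h i).
by rewrite addnS; have := h (i.+1 + d)%nat; lia.
Qed.

Lemma separated_blocks_inj lo hi i i' j : separated_blocks lo hi ->
  (lo i <= j <= hi i)%nat -> (lo i' <= j <= hi i')%nat -> i = i'.
Proof.
move=> h h1 h2; case: (ltngtP i i') => // hl.
  by have := separated_blocks_lt h hl; lia.
by have := separated_blocks_lt h hl; lia.
Qed.

Lemma separated_blocks_ge lo hi i : separated_blocks lo hi -> (i <= lo i)%nat.
Proof. by move=> h; elim: i => // i IH; have := h i; lia. Qed.

Section BlockSeries.
Variables (K : AbsRing) (hK : R_or_C K) (io : R -> K).
Hypothesis ioa : forall r, abs (io r) = Rabs r.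
Variables (lo hi : nat -> nat) (hblk : separated_blocks lo hi).

Lemma norm_scal_real (V : NormedModule K) r (x : V) : 0 <= r ->
  norm (scal (io r) x) = r * norm x.
Proof. by move=> hr; rewrite (norm_scal_eq hK) ioa Rabs_pos_eq. Qed.

Section BasisBlocks.
Variables (X : NormedModule K) (hX : geometrically_complete X) (e : nat -> X).
Hypothesis he : forall x : X, exists! a : nat -> K, is_series (fun j => scal (a j) (e j)) x.
Hypothesis he1 : forall j, norm (e j) = 1.

(** Single terms and blocks of the expansion are differences of at most two partial sums, whence
    twice the basis constant. *)
Lemma coord_bounded : exists B, 0 < B /\
  (forall x j, abs (coord e x j) <= B * norm x) /\
  (forall x a b, norm (sum_n_m (fun j => scal (coord e x j) (e j)) a b) <= B * norm x).
Proof.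
have [B [hB h]] := basis_constant hK hX he he1.
exists (2 * B); split; [lra | split=> x].
  move=> j; rewrite Rmult_assoc; exact: (coord_psum_le hK he1 j (h x)).
move=> a b; have hx := norm_ge_0 x.
case: (leqP a b) => hab; last by rewrite sum_n_m_zero ?norm_zero; [nra|lia].
case: a hab => [|a] hab.
  by have := h x b; rewrite /psum /sum_n; nra.
rewrite sum_n_m_sum_n; last by lia.
apply: Rle_trans (norm_triangle _ _) _; rewrite norm_opp.
apply: Rle_trans (Rplus_le_compat _ _ _ _ (h x b) (h x a)) _; lra.
Qed.

(** The blocks of the [x i] have norm at most [B], so their sum damped by powers of one half
    converges. The blocks being disjoint, coordinate [j] of the partial sums is constant from rank
    [i] on, and it passes to the limit by the bound on coordinates. *)
Lemma block_glue (x : nat -> X) : (forall i, norm (x i) <= 1) ->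
  exists l, forall i j, (lo i <= j <= hi i)%nat ->
    coord e l j = mult (io ((/ 2) ^ i)) (coord e (x i) j).
Proof.
move=> hx; have [B [hB [hB1 hB2]]] := coord_bounded.
pose S i := scal (io ((/ 2) ^ i))
  (sum_n_m (fun j => scal (coord e (x i) j) (e j)) (lo i) (hi i)).
have hS i : norm (S i) <= B * (/ 2) ^ i.
  have h2 := half_pow_gt0 i.
  rewrite /S norm_scal_real; last lra.
  apply: Rle_trans (Rmult_le_compat_l _ _ _ (Rlt_le _ _ h2) (hB2 (x i) (lo i) (hi i))) _.
  have h3 : B * norm (x i) <= B * 1 by apply: Rmult_le_compat_l (hx i); lra.
  have := Rmult_le_compat_l _ _ _ (Rlt_le _ _ h2) h3; lra.
(* Consecutive partial sums differ by the term of rank [i.+1], hence the exponent. *)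
have [||l hl] := hX (u := sum_n S) (rho := fun i => B * (/ 2) ^ i.+1).
- by move=> i; rewrite sum_Sn plus_comm minus_plus_l.
- by move=> i /=; lra.
exists l => i j hj.
apply: (@tends_to_unique K (AbsRing_NormedModule K) (fun I => coord e (sum_n S I) j)).
  apply: (@tends_to_squeeze _ _ _ _ (B * B)) => I.
  have h1 := hB1 (minus (sum_n S I) l) j; rewrite coord_minus // in h1.
  apply: Rle_trans h1 _; apply: Rle_trans (Rmult_le_compat_l _ _ _ (Rlt_le _ _ hB) (hl I)) _.
  by move=> /=; lra.
move=> eps heps; exists i => I hI.
rewrite (_ : coord e (sum_n S I) j = mult (io ((/ 2) ^ i)) (coord e (x i) j)).
  by rewrite minus_eq_zero norm_zero.
have hSj i' : coord e (S i') j = if i' == i then mult (io ((/ 2) ^ i)) (coord e (x i) j) else zero.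
  rewrite /S coord_scal // coord_finite_sum //.
  case: eqP => [->|hne]; first by rewrite hj.
  case: ifP => h; last by rewrite mult_zero_r.
  by case: hne; apply: separated_blocks_inj hblk h hj.
have -> : coord e (sum_n S I) j = sum_n (fun i' => coord e (S i') j) I.
  elim: (I) => [|I' IH]; first by rewrite !sum_O.
  by rewrite !sum_Sn coord_plus // IH.
rewrite /sum_n (@sum_n_m_single _ _ _ _ i) ?hI ?hSj ?eqxx //.
by move=> i' /negbTE hne; rewrite hSj hne.
Qed.

End BasisBlocks.

(** * Series of weighted blocks with arbitrary coefficients *)

Section Phi.
Variables (Y : NormedModule K) (hY : geometrically_complete Y).
Variables (y : nat -> nat -> Y) (s : nat -> R) (C2 p : R).
Hypotheses (hC2 : 0 < C2) (hp : 0 < p) (hs : forall i, 0 < s i).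
Hypothesis hy : forall i (a : nat -> K),
  norm (sum_n_m (fun j => scal (a j) (y i j)) (lo i) (hi i)) <=
  C2 * rpow (sum_n_m (fun j => rpow (abs (a j)) p) (lo i) (hi i)) (/ p).

Definition block_weight i := (/ 2) ^ i * rpow (s i) (- / p).

Definition block_term (g : nat -> K) i : Y :=
  scal (io (block_weight i)) (sum_n_m (fun j => scal (g j) (y i j)) (lo i) (hi i)).

(** The condition that makes the series of [block_term g] converge geometrically. It bears on a
    scalar sequence, so that it also applies to coefficients that are polarized monomials. *)
Definition block_dominated (g : nat -> K) T : Prop := 0 <= T /\ forall i,
  sum_n_m (fun j => rpow (abs (g j)) p) (lo i) (hi i) <= T * s i.

Definition block_sum (g : nat -> K) : Y :=
  epsilon (inhabits zero) (tends_to (sum_n (block_term g))).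

Lemma block_weight_gt0 i : 0 < block_weight i.
Proof.
apply: Rmult_lt_0_compat; first exact: half_pow_gt0.
exact: rpow_gt0.
Qed.

(** The factor [rpow (s i) (- / p)] of the weight cancels the growth [rpow (s i) (/ p)] allowed by
    domination; only the power of one half remains. *)
Lemma block_term_le g T i : block_dominated g T ->
  norm (block_term g i) <= C2 * rpow T (/ p) * (/ 2) ^ i.
Proof.
move=> [hT hg]; have hw := block_weight_gt0 i.
rewrite /block_term norm_scal_real; last lra.
have hpi : 0 <= / p by apply: Rlt_le; exact: Rinv_0_lt_compat.
have h1 : norm (sum_n_m (fun j => scal (g j) (y i j)) (lo i) (hi i)) <=
    C2 * (rpow T (/ p) * rpow (s i) (/ p)).
  apply: Rle_trans (hy i g) _; apply: Rmult_le_compat_l; first lra.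
  rewrite -rpow_mult //; last by apply: Rlt_le.
  apply: rpow_le => //; split=> //.
  by apply: sum_n_m_nonneg => j; exact: rpow_ge0.
apply: Rle_trans (Rmult_le_compat_l _ _ _ (Rlt_le _ _ hw) h1) _.
have h2 := rpow_opp (/ p) (hs i).
rewrite /block_weight; apply: Req_le.
transitivity (C2 * rpow T (/ p) * (/ 2) ^ i * (rpow (s i) (- / p) * rpow (s i) (/ p))).
  by ring.
by rewrite h2 Rmult_1_r.
Qed.

Lemma block_sum_rate g T I : block_dominated g T ->
  norm (minus (sum_n (block_term g) I) (block_sum g)) <=
  C2 * rpow T (/ p) * (/ 2) ^ I.
Proof.
move=> hg; have [||l hl] := hY (u := sum_n (block_term g))
  (rho := fun i => C2 * rpow T (/ p) * (/ 2) ^ i.+1).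
- by move=> i; rewrite sum_Sn plus_comm minus_plus_l; exact: block_term_le.
- by move=> i /=; lra.
have hl' : tends_to (sum_n (block_term g)) l.
  apply: (@tends_to_squeeze _ _ _ _ (C2 * rpow T (/ p))) => i.
  by apply: Rle_trans (hl i) _ => /=; lra.
have hb : tends_to (sum_n (block_term g)) (block_sum g).
  by apply: (epsilon_spec _ (tends_to (sum_n (block_term g)))); exists l.
rewrite (tends_to_unique hb hl'); apply: Rle_trans (hl I) _ => /=; lra.
Qed.

Lemma block_sum_tends_to g T : block_dominated g T ->
  tends_to (sum_n (block_term g)) (block_sum g).
Proof.
move=> hg; apply: (@tends_to_squeeze _ _ _ _ (C2 * rpow T (/ p))) => i.
exact: block_sum_rate.
Qed.

(** [block_sum] is known to be a limit only for dominated coefficients, which is why each of the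
    three sequences carries a bound of its own. *)
Lemma block_sum_linear c g h T T' T'' :
  block_dominated g T -> block_dominated h T' ->
  block_dominated (fun j => plus (mult c (g j)) (h j)) T'' ->
  block_sum (fun j => plus (mult c (g j)) (h j)) = plus (scal c (block_sum g)) (block_sum h).
Proof.
move=> hg hh hgh; apply: tends_to_unique (block_sum_tends_to hgh) _.
have := tends_to_plus (tends_to_scal c (block_sum_tends_to hg)) (block_sum_tends_to hh).
congr tends_to; apply: functional_extensionality => I; symmetry.
rewrite -sum_n_scal_l -sum_n_plus; apply: sum_n_ext => i.
rewrite /block_term scal_assoc (scalar_multC hK c) -scal_assoc -scal_distr_l.
congr scal; rewrite -sum_n_m_scal_l -sum_n_m_plus; apply: sum_n_m_ext => j.
by rewrite scal_distr_r scal_assoc.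
Qed.

Lemma block_sum_single g T i j : block_dominated g T -> (lo i <= j <= hi i)%nat ->
  (forall l, l != j -> g l = zero) ->
  block_sum g = scal (io (block_weight i)) (scal (g j) (y i j)).
Proof.
move=> hg hj hz; apply: tends_to_unique (block_sum_tends_to hg) _.
have hsum i' a b : sum_n_m (fun l => scal (g l) (y i' l)) a b =
    if (a <= j <= b)%nat then scal (g j) (y i' j) else zero.
  by apply: sum_n_m_single => l hl; rewrite hz // scal_zero_l.
have hterm i' : block_term g i' = if i' == i
    then scal (io (block_weight i)) (scal (g j) (y i j)) else zero.
  rewrite /block_term hsum; case: eqP => [->|hne]; first by rewrite hj.
  case: ifP => h; last by rewrite scal_zero_r.
  by case: hne; apply: separated_blocks_inj hblk h hj.
move=> eps heps; exists i => I hI.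
rewrite /sum_n (@sum_n_m_single _ _ _ _ i) ?hI ?hterm ?eqxx.
  by rewrite minus_eq_zero norm_zero.
by move=> i' /negbTE hne; rewrite hterm hne.
Qed.

End Phi.
End BlockSeries.

(** * Monomials in the coordinates *)


Section Monomials.
Variables (K : AbsRing) (hK : R_or_C K) (io : R -> K).
Hypothesis ioa : forall r, abs (io r) = Rabs r.
Hypothesis iom : forall r t, mult (io r) (io t) = io (r * t).
Hypothesis io1 : io 1 = one.
Variables (m : nat) (n : 'I_m -> nat) (X : 'I_m -> NormedModule K).
Variable e : forall k, nat -> X k.
Hypothesis he : forall k (x : X k),
  exists! a : nat -> K, is_series (fun j => scal (a j) (e k j)) x.
Variable B : 'I_m -> R.
Hypothesis hB0 : forall k, 0 < B k.
Hypothesis hB : forall k x j, abs (coord (e k) x j) <= B k * norm x.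

Definition monomial (x : forall k, X k) (j : nat) : K :=
  \big[mult/one]_(k < m) pow_n (coord (e k) (x k) j) (n k).

(** [r] to the total degree [n_1 + ... + n_m], written as a product to match [monomial]. *)
Definition scale_factor (r : R) : R := \big[Rmult/1]_(k < m) r ^ n k.

Definition monomial_bound : R := \big[Rmult/1]_(k < m) B k ^ n k.

Definition in_unit_ball (x : forall k, X k) : Prop := forall k, norm (x k) <= 1.

Lemma abs_monomial x j :
  abs (monomial x j) = \big[Rmult/1]_(k < m) abs (coord (e k) (x k) j) ^ n k.
Proof. by rewrite abs_big //; apply: eq_bigr => k _; rewrite (scalar_abs_pow hK). Qed.

Lemma scale_factor_gt0 r : 0 < r -> 0 < scale_factor r.
Proof. by move=> hr; apply: prod_gt0 => k; exact: pow_lt. Qed.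

(** Only coordinates of index [j] are compared: this serves rescaled points and also the glued
    point, which is proportional to a given point on one block only. *)
Lemma abs_monomial_mult x x' r j : 0 <= r ->
  (forall k, coord (e k) (x' k) j = mult (io r) (coord (e k) (x k) j)) ->
  abs (monomial x' j) = scale_factor r * abs (monomial x j).
Proof.
move=> hr h; rewrite !abs_monomial -big_split; apply: eq_bigr => k _.
by rewrite h (scalar_abs_mult hK) ioa Rabs_pos_eq // Rpow_mult_distr.
Qed.

Lemma abs_monomial_le x j : in_unit_ball x -> abs (monomial x j) <= monomial_bound.
Proof.
move=> hx; rewrite abs_monomial; apply: prod_le => k.
have h0 := abs_ge_0 (coord (e k) (x k) j).
split; first exact: pow_le.
apply: pow_incr; split=> //; apply: Rle_trans (hB (x k) j) _.
have := Rmult_le_compat_l _ _ _ (Rlt_le _ _ (hB0 k)) (hx k); lra.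
Qed.

Lemma rescale_to_unit_ball (x : forall k, X k) r :
  0 < r -> (forall k, norm (x k) <= r) -> exists x' : forall k, X k,
    in_unit_ball x' /\ forall j, abs (monomial x j) = scale_factor r * abs (monomial x' j).
Proof.
move=> hr hx; have hir : 0 < / r by exact: Rinv_0_lt_compat.
exists (fun k => scal (io (/ r)) (x k)); split.
  move=> k; rewrite (norm_scal_real hK ioa); last lra.
  have := Rmult_le_compat_l _ _ _ (Rlt_le _ _ hir) (hx k).
  by rewrite Rinv_l //; lra.
move=> j; apply: abs_monomial_mult => [|k]; first lra.
rewrite coord_scal // mult_assoc iom Rinv_r; last lra.
by rewrite io1 mult_one_l.
Qed.

(** * Choice of the blocks *)

Variables (q : R) (hq : 0 < q).

Definition block_energy lo hi x : R :=
  sum_n_m (fun j => rpow (abs (monomial x j)) q) lo hi.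

(** On a finite block the energy is bounded over the unit balls, but its supremum need not be
    attained; a point exceeding half of it is taken, whence the factor 2. *)
Lemma near_maximal_block (x0 : forall k, X k) : in_unit_ball x0 ->
  ~ ex_series (fun j => rpow (abs (monomial x0 j)) q) ->
  forall lo L, 0 < L -> exists hi (x : forall k, X k),
    [/\ (lo <= hi)%nat, in_unit_ball x, L <= block_energy lo hi x &
        forall x', in_unit_ball x' -> block_energy lo hi x' <= 2 * block_energy lo hi x].
Proof.
move=> hx0 hdiv lo L hL.
(* Asking for [2 * L] leaves at least [L] after the supremum is halved. *)
have [hi [hlo hhi]] := divergent_tail (fun j => rpow_ge0 _ _) hdiv lo (2 * L).
pose E t := exists x, in_unit_ball x /\ t = block_energy lo hi x.
have [||M [hM1 hM2]] := completeness E.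
- exists (INR (hi.+1 - lo)%coq_nat * rpow monomial_bound q) => t [x [hx ->]].
  rewrite -sum_n_m_const; apply: sum_n_m_le => j; apply: rpow_le; first lra.
  by split; [exact: abs_ge_0 | exact: abs_monomial_le].
- by exists (block_energy lo hi x0), x0.
have hM : 2 * L <= M by apply: Rle_trans hhi _; apply: hM1; exists x0.
have [x [hx hMx]] : exists x, in_unit_ball x /\ M / 2 < block_energy lo hi x.
  apply: NNPP => hno; have : M <= M / 2; last lra.
  apply: hM2 => t [x [hx ->]]; apply: Rnot_lt_le => hlt; apply: hno.
  by exists x.
exists hi, x; split=> //; first lra.
move=> x' hx'; apply: (@Rle_trans _ M); last lra.
by apply: hM1; exists x'.
Qed.

Lemma hump_blocks (x0 : forall k, X k) (L : nat -> R) : in_unit_ball x0 ->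
  ~ ex_series (fun j => rpow (abs (monomial x0 j)) q) -> (forall i, 0 < L i) ->
  exists (lo hi : nat -> nat) (x : nat -> forall k, X k),
    separated_blocks lo hi /\ forall i,
    [/\ in_unit_ball (x i), L i <= block_energy (lo i) (hi i) (x i) &
        forall x', in_unit_ball x' ->
          block_energy (lo i) (hi i) x' <= 2 * block_energy (lo i) (hi i) (x i)].
Proof.
move=> hx0 hdiv hL.
have H lo i : exists d : nat * (forall k, X k),
    [/\ (lo <= d.1)%nat, in_unit_ball d.2, L i <= block_energy lo d.1 d.2 &
        forall x', in_unit_ball x' -> block_energy lo d.1 x' <= 2 * block_energy lo d.1 d.2].
  by have [hi [x hx]] := near_maximal_block hx0 hdiv lo (hL i); exists (hi, x).
pose f lo i := proj1_sig (constructive_indefinite_description _ (H lo i)).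
have fP lo i : [/\ (lo <= (f lo i).1)%nat, in_unit_ball (f lo i).2,
    L i <= block_energy lo (f lo i).1 (f lo i).2 &
    forall x', in_unit_ball x' ->
      block_energy lo (f lo i).1 x' <= 2 * block_energy lo (f lo i).1 (f lo i).2].
  exact: (proj2_sig (constructive_indefinite_description _ (H lo i))).
pose lo := fix lo i : nat := if i is i'.+1 then (f (lo i') i').1.+1 else 0%nat.
exists lo, (fun i => (f (lo i) i).1), (fun i => (f (lo i) i).2).
split=> i; have [h1 h2 h3 h4] := fP (lo i) i; last by split.
by split=> //=.
Qed.

(** * The polynomial built from the blocks *)

Section SummedPolynomial.
Variables (lo hi : nat -> nat) (hblk : separated_blocks lo hi).
Variables (Y : NormedModule K) (hY : geometrically_complete Y).
Variables (y : nat -> nat -> Y) (s : nat -> R) (C2 p : R).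
Hypotheses (hC2 : 0 < C2) (hp : 0 < p) (hqp : q < p) (hs : forall i, 0 < s i).
Hypothesis hy : forall i (a : nat -> K),
  norm (sum_n_m (fun j => scal (a j) (y i j)) (lo i) (hi i)) <=
  C2 * rpow (sum_n_m (fun j => rpow (abs (a j)) p) (lo i) (hi i)) (/ p).
Hypothesis henergy : forall i x, in_unit_ball x ->
  block_energy (lo i) (hi i) x <= 2 * s i.

Definition summed_poly (x : forall k, X k) : Y :=
  block_sum io lo hi y s p (monomial x).

(** The factor [rpow monomial_bound (p - q)] pays for replacing exponent [p] by [q] on the unit
    ball, 2 comes from near-maximality, and the power of [scale_factor r] from passing to radius
    [r]. *)
Definition energy_bound r : R :=
  rpow (scale_factor r) p * (rpow monomial_bound (p - q) * 2).

Lemma monomial_dominated x r : 0 < r -> (forall k, norm (x k) <= r) ->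
  block_dominated lo hi s p (monomial x) (energy_bound r).
Proof.
move=> hr hx; have hsc := scale_factor_gt0 hr.
split.
  by apply: Rmult_le_pos (rpow_ge0 _ _) _; have := rpow_ge0 monomial_bound (p - q); lra.
move=> i; have [x' [hx' hxx']] := rescale_to_unit_ball hr hx.
apply: (@Rle_trans _ (sum_n_m (fun j => (rpow (scale_factor r) p * rpow monomial_bound (p - q)) *
    rpow (abs (monomial x' j)) q) (lo i) (hi i))).
  apply: sum_n_m_le => j; have h0 := abs_ge_0 (monomial x' j).
  rewrite hxx' rpow_mult //; last lra.
  rewrite {2}(_ : p = (p - q) + q); last lra.
  rewrite rpow_add // Rmult_assoc; apply: Rmult_le_compat_l (rpow_ge0 _ _) _.
  apply: Rmult_le_compat_r (rpow_ge0 _ _) _; apply: rpow_le; first lra.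
  by split=> //; exact: abs_monomial_le.
rewrite sum_n_m_Rmult_l /energy_bound.
have h1 : 0 <= rpow (scale_factor r) p * rpow monomial_bound (p - q).
  by apply: Rmult_le_pos; exact: rpow_ge0.
have := Rmult_le_compat_l _ _ _ h1 (henergy i hx'); rewrite /block_energy; lra.
Qed.

Lemma family_radius (x : forall k, X k) : exists r, 0 < r /\ forall k, norm (x k) <= r.
Proof. exact: (bounded_family (fun k => norm (x k))). Qed.

(* The factor at [k] of the monomial, polarized: the [n k] arguments [v] enter
   one coordinate each. *)
Definition polarized_monomial (x : forall k, X k) (k : 'I_m) (v : 'I_(n k) -> X k) (j : nat) : K :=
  mult (\big[mult/one]_(i < n k) coord (e k) (v i) j)
    (\big[mult/one]_(l < m | l != k) pow_n (coord (e l) (x l) j) (n l)).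

Lemma monomial_dfwith x k (u : X k) j :
  monomial (dfwith x u) j = polarized_monomial x (fun=> u) j.
Proof.
rewrite /monomial (scalar_bigD1 hK k) dfwith_in /polarized_monomial big_const_pow_n.
congr mult; apply: eq_bigr => l hl.
by rewrite dfwith_out // eq_sym.
Qed.

Hypothesis hn : forall k, (0 < n k)%nat.

(* The product over [v] is at most the [n k]-th power of its largest factor. *)
Lemma polarized_monomial_le x k (v : 'I_(n k) -> X k) j : exists i,
  abs (polarized_monomial x v j) <= abs (monomial (dfwith x (v i)) j).
Proof.
have [i hmax] := family_argmax (fun i => abs (coord (e k) (v i) j)) (hn k).
exists i; rewrite monomial_dfwith /polarized_monomial !(scalar_abs_mult hK).
apply: Rmult_le_compat_r (abs_ge_0 _) _; rewrite !abs_big //.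
by apply: prod_le => l; split; [exact: abs_ge_0 | exact: hmax].
Qed.

(** Which of the vectors [v i] has the largest coordinate varies with [j]; adding the bounds for all
    [i] covers every case and produces [n k] copies of [T]. *)
Lemma polarized_monomial_dominated x k (v : 'I_(n k) -> X k) :
  exists T, block_dominated lo hi s p (polarized_monomial x v) T.
Proof.
have [r1 [hr1 h1]] := family_radius x.
have [r2 [hr2 h2]] := bounded_family (fun i => norm (v i)).
have hdom i : block_dominated lo hi s p (monomial (dfwith x (v i))) (energy_bound (r1 + r2)).
  apply: monomial_dominated; first lra.
  move=> l; case: dfwithP => [|l' _]; first by have := h2 i; lra.
  by have := h1 l'; lra.
have [hT _] := hdom (Ordinal (hn k)).
set T := energy_bound _ in hdom hT.
exists (\big[Rplus/0]_(i < n k) T); split.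
  by apply: big_ind => // [|? ?]; [exact: Rle_refl | exact: Rplus_le_le_0_compat].
move=> b; apply: (@Rle_trans _ (sum_n_m (fun j =>
    \big[Rplus/0]_(i < n k) rpow (abs (monomial (dfwith x (v i)) j)) p) (lo b) (hi b))).
  apply: sum_n_m_le => j; have [i hi'] := polarized_monomial_le x v j.
  rewrite (bigD1 i) //=; apply: (@Rle_trans _ (rpow (abs (monomial (dfwith x (v i)) j)) p)).
    by apply: rpow_le; [lra | split=> //; exact: abs_ge_0].
  rewrite -[X in X <= _]Rplus_0_r; apply: Rplus_le_compat_l.
  apply: big_ind => // [|? ?|? _]; [exact: Rle_refl | exact: Rplus_le_le_0_compat | exact: rpow_ge0].
rewrite sum_n_m_big exchange_big /=.
rewrite (big_morph (fun t => t * s b) (fun t u => Rmult_plus_distr_r t u (s b)) (Rmult_0_l (s b))).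
apply: (big_ind2 (fun t u : R => t <= u)) => [|t t' u u'|i _].
- exact: Rle_refl.
- exact: Rplus_le_compat.
by rewrite -sum_n_m_big; have [_] := hdom i; exact.
Qed.

(** The multilinear map is [block_sum] applied to the polarized monomials, each of which is linear
    in every [v i]. *)
Lemma summed_poly_multilinear (x : forall k, X k) (k : 'I_m) :
  homogeneous_poly (n k) (fun u : X k => summed_poly (dfwith x u)).
Proof.
exists (fun v => block_sum io lo hi y s p (polarized_monomial x v)); split; last first.
  move=> u; rewrite /summed_poly; congr block_sum.
  by apply: functional_extensionality => j; exact: monomial_dfwith.
move=> v i c u w x_with.
have [T hT] := polarized_monomial_dominated x (x_with u).
have [T' hT'] := polarized_monomial_dominated x (x_with w).
have [T'' hT''] := polarized_monomial_dominated x (x_with (plus (scal c u) w)).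
have hlin : polarized_monomial x (x_with (plus (scal c u) w)) =
    (fun j => plus (mult c (polarized_monomial x (x_with u) j)) (polarized_monomial x (x_with w) j)).
  apply: functional_extensionality => j; rewrite /polarized_monomial.
  rewrite (@big_linear_entry K hK _ i _ (fun l => coord (e k) (x_with u l) j)
    (fun l => coord (e k) (x_with w l) j) c).
  - by rewrite mult_distr_r -mult_assoc.
  - by move=> l hl; rewrite /x_with !dfwith_out // eq_sym.
  - by move=> l hl; rewrite /x_with !dfwith_out // eq_sym.
  - by rewrite /x_with !dfwith_in coord_plus // coord_scal.
rewrite hlin in hT'' *.
exact: (block_sum_linear hK ioa hY hC2 hp hs hy hT hT' hT'').
Qed.

(** The neighbourhood filter of [x] for the maximum norm, in the shape of [multi_continuous], so
    that the limit rules for filters apply. *)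
Definition family_nbhs (x : forall k, X k) (U : (forall k, X k) -> Prop) : Prop :=
  exists delta : posreal, forall z, (forall k, norm (minus (z k) (x k)) < delta) -> U z.

Instance family_nbhs_filter x : Filter (family_nbhs x).
Proof.
split.
- by exists (mkposreal 1 Rlt_0_1).
- move=> U V [d1 h1] [d2 h2].
  exists (mkposreal _ (Rmin_stable_in_posreal d1 d2)) => z /= hz.
  split; [apply: h1 | apply: h2] => k; apply: Rlt_le_trans (hz k) _.
    exact: Rmin_l.
  exact: Rmin_r.
- by move=> U V hUV [d h]; exists d => z /h; exact: hUV.
Qed.

Lemma coord_continuous x k j :
  filterlim (fun z : forall k, X k => coord (e k) (z k) j : AbsRing_NormedModule K)
    (family_nbhs x) (locally (coord (e k) (x k) j : AbsRing_NormedModule K)).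
Proof.
apply/filterlim_locally_ball_norm => eps.
have hd : 0 < eps / B k by apply: Rdiv_lt_0_compat => //; exact: cond_pos.
exists (mkposreal _ hd) => z /= hz; rewrite /ball_norm.
have h := hB (minus (z k) (x k)) j; rewrite coord_minus // in h.
apply: Rle_lt_trans h _.
have := Rmult_lt_compat_l _ _ _ (hB0 k) (hz k).
by rewrite (_ : B k * (eps / B k) = eps) //; field; have := hB0 k; lra.
Qed.

Lemma monomial_continuous x j :
  filterlim (fun z => monomial z j) (family_nbhs x) (locally (monomial x j)).
Proof.
have hpow k i : filterlim (fun z : forall k, X k => pow_n (coord (e k) (z k) j) i)
    (family_nbhs x) (locally (pow_n (coord (e k) (x k) j) i)).
  elim: i => [|i IH] /=; first exact: filterlim_const.
  exact: (@filterlim_comp_2 _ K K K _ _ _ _ _ _ _ (@mult K) (@coord_continuous x k j) IH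
    (filterlim_mult _ _)).
rewrite /monomial; elim: (index_enum _) => [|k r IH].
  rewrite big_nil; apply: filterlim_ext (filterlim_const _) => z; by rewrite big_nil.
rewrite big_cons; apply: (@filterlim_ext _ _ _ _ _ (fun z : forall k, X k =>
  mult (pow_n (coord (e k) (z k) j) (n k))
       (\big[mult/one]_(k <- r) pow_n (coord (e k) (z k) j) (n k)))).
  by move=> z; rewrite big_cons.
exact: (@filterlim_comp_2 _ K K K _ _ _ _ _ _ _ (@mult K) (hpow k (n k)) IH (filterlim_mult _ _)).
Qed.

Lemma block_partial_continuous x I :
  filterlim (fun z => sum_n (block_term io lo hi y s p (monomial z)) I)
    (family_nbhs x) (locally (sum_n (block_term io lo hi y s p (monomial x)) I)).
Proof.
have hsum (f : (forall k, X k) -> nat -> Y) a b :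
    (forall j, filterlim (fun z => f z j) (family_nbhs x) (locally (f x j))) ->
    filterlim (fun z => sum_n_m (f z) a b) (family_nbhs x) (locally (sum_n_m (f x) a b)).
  move=> hf; case: (leqP a b) => hab; last first.
    rewrite sum_n_m_zero; last by lia.
    by apply: filterlim_ext (filterlim_const _) => z; rewrite sum_n_m_zero //; lia.
  rewrite -(subnKC hab); elim: (b - a)%nat => [|d IH].
    rewrite addn0 sum_n_n.
    by apply: filterlim_ext (hf a) => z; rewrite sum_n_n.
  rewrite addnS sum_n_Sm; last by lia.
  apply: (@filterlim_ext _ _ _ _ _ (fun z => plus (sum_n_m (f z) a (a + d)%nat) (f z (a + d).+1))).
    by move=> z; rewrite sum_n_Sm //; lia.
  exact: (@filterlim_comp_2 _ Y Y Y _ _ _ _ _ _ _ (@plus Y) IH (hf _) (filterlim_plus _ _)).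
apply: (hsum (fun z => block_term io lo hi y s p (monomial z))) => i; rewrite /block_term.
apply: filterlim_comp (filterlim_scal_r _ _).
apply: hsum => j.
apply: filterlim_comp (@monomial_continuous x j) (filterlim_scal_l _ _).
Qed.

(** A locally uniform limit of continuous maps: points within 1 of [x] have entries of norm at most
    [r + 1], where one geometric sequence bounds all the remainders. *)
Lemma summed_poly_continuous (x : forall k, X k) (eps : posreal) :
  exists delta : posreal, forall z : forall k, X k,
    (forall k, norm (minus (z k) (x k)) < delta) ->
    norm (minus (summed_poly z) (summed_poly x)) < eps.
Proof.
have [r [hr hx]] := family_radius x.
have hr1 : 0 < r + 1 by lra.
set T := energy_bound (r + 1).
have hrate z I : (forall k, norm (minus (z k) (x k)) < 1) ->
    norm (minus (sum_n (block_term io lo hi y s p (monomial z)) I) (summed_poly z)) <=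
    C2 * rpow T (/ p) * (/ 2) ^ I.
  move=> hz; apply: (block_sum_rate hK ioa hY hC2 hp hs hy).
  apply: monomial_dominated => // k.
  have := norm_triangle (minus (z k) (x k)) (x k); rewrite minus_plus_r.
  move=> h; apply: Rle_trans h _; apply: Rle_trans (Rplus_le_compat _ _ _ _ (Rlt_le _ _ (hz k)) (hx k)) _.
  lra.
have he3 : 0 < eps / 3 by have := cond_pos eps; lra.
have [I hI] : exists I, C2 * rpow T (/ p) * (/ 2) ^ I < eps / 3.
  have [I hI] := half_pow_small (C2 * rpow T (/ p)) he3.
  by exists I; exact: hI.
have [d hd] := proj1 (filterlim_locally_ball_norm _ _) (@block_partial_continuous x I) (mkposreal _ he3).
exists (mkposreal _ (Rmin_stable_in_posreal d (mkposreal 1 Rlt_0_1))) => z /= hz.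
have hz1 k : norm (minus (z k) (x k)) < 1 by apply: Rlt_le_trans (hz k) (Rmin_r _ _).
have hzd k : norm (minus (z k) (x k)) < d by apply: Rlt_le_trans (hz k) (Rmin_l _ _).
have hx1 k : norm (minus (x k) (x k)) < 1 by rewrite minus_eq_zero norm_zero; lra.
have h1 := hrate z I hz1; have h2 := hrate x I hx1; have h3 := hd z hzd.
rewrite /ball_norm /= in h3.
set Sz := sum_n _ I in h1 h3; set Sx := sum_n _ I in h2 h3.
apply: Rle_lt_trans (norm_minus_triangle Sz _ _) _.
rewrite (norm_minus_sym _ Sz); have h4 := norm_minus_triangle Sx Sz (summed_poly x).
lra.
Qed.

Hypothesis hm : (0 < m)%nat.

(** One variable of positive degree suffices: its vanishing coordinate annihilates the product. *)
Lemma monomial_basis_scal (a : 'I_m -> nat -> K) j l : l != j ->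
  monomial (fun k => scal (a k j) (e k j)) l = zero.
Proof.
move=> hl; rewrite /monomial (scalar_bigD1 hK (Ordinal hm)).
rewrite coord_basis_scal // (negbTE hl).
by case: (n _) (hn (Ordinal hm)) => // i _ /=; rewrite !mult_zero_l.
Qed.

Lemma summed_poly_basis_scal (a : 'I_m -> nat -> K) i j : (lo i <= j <= hi i)%nat ->
  norm (summed_poly (fun k => scal (a k j) (e k j))) =
  block_weight s p i * abs (\big[mult/one]_(k < m) pow_n (a k j) (n k)) * norm (y i j).
Proof.
move=> hj; have [r [hr hx]] := family_radius (fun k => scal (a k j) (e k j)).
rewrite /summed_poly (block_sum_single hK ioa hblk hY hC2 hp hs hy (monomial_dominated hr hx) hj).
  rewrite (norm_scal_real hK ioa); last by have := block_weight_gt0 p hs i; lra.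
  rewrite (norm_scal_eq hK) Rmult_assoc; congr (_ * (abs _ * _)).
  by apply: eq_bigr => k _; rewrite coord_basis_scal // eqxx.
by move=> l hl; exact: monomial_basis_scal.
Qed.

End SummedPolynomial.
End Monomials.

(** * The gliding hump *)


Lemma sum_n_m_shift (G : AbelianMonoid) (f : nat -> G) a b d :
  sum_n_m f (a + d)%nat (b + d)%nat = sum_n_m (fun j => f (j + d)%nat) a b.
Proof.
elim: d f => [|d IH] f.
  by rewrite !addn0; apply: sum_n_m_ext => j; rewrite addn0.
rewrite !addnS -sum_n_m_S IH; apply: sum_n_m_ext => j.
by rewrite addnS.
Qed.

Lemma shifted_p_sum (K : AbsRing) (Y : NormedModule K) (C1 C2 p : R)
  (hY : forall N : nat, exists y : nat -> Y,
      (forall j, (1 <= j <= N)%nat -> C1 <= norm (y j)) /\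
      forall a : nat -> K,
        norm (sum_n_m (fun j => scal (a j) (y j)) 1 N)
          <= C2 * rpow (sum_n_m (fun j => rpow (abs (a j)) p) 1 N) (/ p))
  (lo hi : nat) : (lo <= hi)%nat -> exists y : nat -> Y,
    (forall j, (lo <= j <= hi)%nat -> C1 <= norm (y j)) /\
    forall a : nat -> K,
      norm (sum_n_m (fun j => scal (a j) (y j)) lo hi)
        <= C2 * rpow (sum_n_m (fun j => rpow (abs (a j)) p) lo hi) (/ p).
Proof.
move=> hlh; have [y [h1 h2]] := hY (hi - lo).+1.
exists (fun j => y (j.+1 - lo)%nat); split.
  by move=> j hj; apply: h1; lia.
move=> a; have := h2 (fun j => a (j.-1 + lo)%nat).
have hsh (G : AbelianMonoid) (f g : nat -> G) :
    (forall j, f (j + lo)%nat = g j.+1) ->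
    sum_n_m f lo hi = sum_n_m g 1 (hi - lo).+1.
  move=> hfg; rewrite -sum_n_m_S -{1}(add0n lo) -{1}(subnK hlh) sum_n_m_shift.
  exact: sum_n_m_ext.
rewrite -(hsh _ (fun j => scal (a j) (y (j.+1 - lo)%nat))); last first.
  by move=> j; rewrite -addSn addnK.
by rewrite -(hsh _ (fun j => rpow (abs (a j)) p)).
Qed.

Lemma divergence_threshold (g r : R) : 0 < g -> 0 < r ->
  exists L, 0 < L /\ forall s, L <= s -> 1 <= g * rpow s r.
Proof.
move=> hg hr; have hig : 0 < / g by exact: Rinv_0_lt_compat.
(* The solution of [g * rpow s r = 1]. *)
exists (rpow (/ g) (/ r)); split; first exact: rpow_gt0.
move=> s hs; have h : / g <= rpow s r.
  rewrite {1}(_ : / g = rpow (rpow (/ g) (/ r)) r).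
    apply: rpow_le; first lra.
    by split=> //; exact: rpow_ge0.
  rewrite rpow_rpow; last lra.
  by rewrite Rinv_l ?rpowE ?Rpower_1 //; lra.
have := Rmult_le_compat_l _ _ _ (Rlt_le _ _ hg) h; rewrite Rinv_r; lra.
Qed.

Lemma block_sums_not_summable (f : nat -> R) lo hi : separated_blocks lo hi ->
  (forall i, 1 <= sum_n_m f (lo i) (hi i)) -> ~ ex_series f.
Proof.
move=> hblk h1 hf.
have [N hN] := @Cauchy_ex_series _ R_CompleteNormedModule _ hf (mkposreal 1 Rlt_0_1).
have hlo := @separated_blocks_ge _ _ N hblk; have [hlh _] := hblk N.
have : Rabs (sum_n_m f (lo N) (hi N)) < 1 by apply: hN; lia.
have := Rle_abs (sum_n_m f (lo N) (hi N)); have := h1 N; lra.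
Qed.

Lemma monomial_summable (K : AbsRing) (hK : R_or_C K)
    (m : nat) (hm : (0 < m)%nat) (n : 'I_m -> nat) (hn : forall k, (0 < n k)%nat)
    (q : R) (hq : 0 < q) (Y : CompleteNormedModule K)
    (C1 C2 p : R) (hC1 : 0 < C1) (hC2 : 0 < C2)
    (hY : forall N : nat, exists y : nat -> Y,
        (forall j, (1 <= j <= N)%nat -> C1 <= norm (y j)) /\
        forall a : nat -> K,
          norm (sum_n_m (fun j => scal (a j) (y j)) 1 N)
            <= C2 * rpow (sum_n_m (fun j => rpow (abs (a j)) p) 1 N) (/ p))
    (X : 'I_m -> CompleteNormedModule K) (e : forall k, nat -> X k)
    (he : forall k, normalized (e k) /\ unconditional_basis (e k))
    (hqp : q < p)
    (hP : forall P : (forall k, X k) -> Y, continuous_multipoly n P -> as_summing n q P)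
    (x : forall k, X k) :
  ex_series (fun j => rpow (abs (@monomial K m n X e x j)) q).
Proof.
apply: NNPP => hdiv.
have [io [ioa [iom io1]]] := scalar_real_embedding hK.
(* The same spaces with completeness forgotten, the form in which [coord] and [monomial] take
   them. *)
pose X' (k : 'I_m) : NormedModule K := X k.
have hX' (k : 'I_m) : geometrically_complete (X' k) by exact: complete_geometrically.
have hY' : geometrically_complete Y by exact: complete_geometrically.
have hb (k : 'I_m) : forall x : X' k,
    exists! a : nat -> K, is_series (fun j => scal (a j) (e k j)) x.
  by have [_ [h _]] := he k.
have hb1 (k : 'I_m) : forall j, norm (e k j : X' k) = 1 by have [h _] := he k.
have exB (k : 'I_m) : exists B, 0 < B /\
    forall (x : X' k) j, abs (coord (e k) x j) <= B * norm x.
  by have [B [h1 [h2 _]]] := coord_bounded hK (hX' k) (hb k) (hb1 k); exists B.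
pose B k := proj1_sig (constructive_indefinite_description _ (exB k)).
have hB0 k : 0 < B k.
  by have [] := proj2_sig (constructive_indefinite_description _ (exB k)).
have hB (k : 'I_m) (z : X' k) j : abs (coord (e k) z j) <= B k * norm z.
  by have [_] := proj2_sig (constructive_indefinite_description _ (exB k)); exact.
have [r [hr hxr]] := family_radius (x : forall k, X' k).
have [x0 [hx0 hxx0]] := rescale_to_unit_ball hK ioa iom io1 n hb hr hxr.
have {}hdiv : ~ ex_series (fun j => rpow (abs (@monomial K m n X' e x0 j)) q).
  move=> h; apply: hdiv.
  apply: ex_series_ext (ex_series_scal (rpow (scale_factor n r) q) _ h) => j.
  rewrite hxx0 rpow_mult //; last exact: abs_ge_0.
  by apply: Rlt_le; exact: scale_factor_gt0.
have hp : 0 < p by lra.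
have hscale i : 0 < scale_factor n ((/ 2) ^ i).
  by apply: scale_factor_gt0; exact: half_pow_gt0.
(* The three factors are the power of one half in the weight, the damping of the glued point raised
   to the total degree, and the lower bound for the norms of the [y i j]. *)
pose g i := rpow ((/ 2) ^ i * scale_factor n ((/ 2) ^ i) * C1) q.
have hg0 i : 0 < (/ 2) ^ i * scale_factor n ((/ 2) ^ i) * C1.
  by apply: Rmult_lt_0_compat => //; apply: Rmult_lt_0_compat => //; exact: half_pow_gt0.
(* The exponent is [1 - q / p]: the weight raised to the power [q] contributes [- q / p], the energy
   of the block contributes 1. *)
have hr1 : 0 < - / p * q + 1.
  have : q / p < 1 by apply/Rlt_div_l; lra.
  rewrite /Rdiv; lra.
have exL i := divergence_threshold (rpow_gt0 q (hg0 i)) hr1.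
pose L i := proj1_sig (constructive_indefinite_description _ (exL i)).
have hL0 i : 0 < L i.
  by have [] := proj2_sig (constructive_indefinite_description _ (exL i)).
have hL i t : L i <= t -> 1 <= g i * rpow t (- / p * q + 1).
  by have [_] := proj2_sig (constructive_indefinite_description _ (exL i)); exact.
have [lo [hi [xs [hblk hxs]]]] := hump_blocks hK hB0 hB hq hx0 hdiv hL0.
pose s i := block_energy n e q (lo i) (hi i) (xs i).
have hs i : 0 < s i by have [_ h _] := hxs i; exact: Rlt_le_trans (hL0 i) h.
have hyb i := shifted_p_sum hY (proj1 (hblk i)).
pose y i := proj1_sig (constructive_indefinite_description _ (hyb i)).
have hy1 i j : (lo i <= j <= hi i)%nat -> C1 <= norm (y i j).
  by have [h _] := proj2_sig (constructive_indefinite_description _ (hyb i)); exact: h.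
have hy2 i : forall (a : nat -> K),
    norm (sum_n_m (fun j => scal (a j) (y i j)) (lo i) (hi i)) <=
    C2 * rpow (sum_n_m (fun j => rpow (abs (a j)) p) (lo i) (hi i)) (/ p).
  by have [_] := proj2_sig (constructive_indefinite_description _ (hyb i)).
have hmax i x' : in_unit_ball x' -> block_energy n e q (lo i) (hi i) x' <= 2 * s i.
  by have [_ _] := hxs i; exact.
pose P := summed_poly io n (e : forall k, nat -> X' k) lo hi (y : nat -> nat -> CompleteNormedModule.NormedModule K Y) s p.
have hPc : continuous_multipoly n (P : (forall k, X k) -> Y).
  split.
    exact: (summed_poly_multilinear hK ioa iom io1 hb hB0 hB hY' hC2 hp hqp hs hy2 hmax hn).
  exact: (summed_poly_continuous hK ioa iom io1 hb hB0 hB hY' hC2 hp hqp hs hy2 hmax).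
have hxs1 k i : norm (xs i k) <= 1 by have [h _ _] := hxs i; exact: h.
have hglue k := block_glue hK ioa hblk (hX' k) (hb k) (hb1 k) (hxs1 k).
pose xx k := proj1_sig (constructive_indefinite_description _ (hglue k)).
have hxx k i j : (lo i <= j <= hi i)%nat ->
    coord (e k) (xx k : X' k) j = mult (io ((/ 2) ^ i)) (coord (e k) (xs i k) j).
  exact: (proj2_sig (constructive_indefinite_description _ (hglue k))).
have [_ hsum] := hP _ hPc.
have {}hsum := hsum (fun k j => scal (coord (e k) (xx k : X' k) j) (e k j)) _.
apply: (block_sums_not_summable hblk) (hsum _); last first.
  move=> k; apply: (ell1w_unconditional hK); have [_ [_ h]] := he k.
  by apply: (h (xx k)); exact: (coord_is_series (hb k)).
move=> i.
have h2 := half_pow_gt0 i.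
have hsi : 0 < rpow (s i) (- / p) by exact: rpow_gt0.
have [hball hLs _] := hxs i.
apply: Rle_trans (hL i _ hLs) _.
rewrite -/(s i) rpow_add; last by apply: Rlt_le.
rewrite (_ : rpow (s i) 1 = s i); last by rewrite rpowE // Rpower_1.
rewrite -rpow_rpow; last by apply: Rlt_le.
rewrite /g -Rmult_assoc -rpow_mult; try by apply: Rlt_le.
(* The factor [s i] outside the powers is expanded into its sum, which reduces the inequality to
   single terms. *)
rewrite {2}/s /block_energy -sum_n_m_Rmult_l.
apply: sum_n_m_le_loc => j hj.
rewrite -rpow_mult; [| |exact: abs_ge_0]; last by apply: Rlt_le; exact: Rmult_lt_0_compat.
apply: rpow_le; first lra.
have hmon := abs_ge_0 (monomial n (e : forall k, nat -> X' k) (xs i) j).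
split.
  by apply: Rmult_le_pos => //; apply: Rlt_le; exact: Rmult_lt_0_compat.
have hPj := summed_poly_basis_scal hK ioa iom io1 hb hB0 hB hblk hY' hC2 hp hqp hs hy2
  hmax hn hm (fun k j => coord (e k) (xx k : X' k) j) hj.
apply: Rle_trans (Req_le _ _ (esym hPj)).
have hmono : abs (\big[mult/one]_(k < m) pow_n (coord (e k) (xx k : X' k) j) (n k)) =
    scale_factor n ((/ 2) ^ i) * abs (monomial n (e : forall k, nat -> X' k) (xs i) j).
  apply: (abs_monomial_mult hK ioa n (x := xs i) (x' := xx)); first lra.
  by move=> k; exact: hxx.
rewrite hmono /block_weight.
set b := abs _ in hmon *.
have hc : 0 <= (/ 2) ^ i * rpow (s i) (- / p) * (scale_factor n ((/ 2) ^ i) * b).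
  have := hscale i => hsc.
  by repeat apply: Rmult_le_pos; lra.
by have := Rmult_le_compat_l _ _ _ hc (hy1 i j hj); lra.
Qed.

Unset Implicit Arguments.
Set Strict Implicit.
Set Printing Implicit Defensive.

Theorem lemma3p6 (K : AbsRing) (hK : R_or_C K)
    (m : nat) (hm : (0 < m)%nat) (n : 'I_m -> nat) (hn : forall k, (0 < n k)%nat)
    (q : R) (hq : 0 < q)
    (Y : CompleteNormedModule K)
    (C1 C2 p : R) (hC1 : 0 < C1) (hC2 : 0 < C2) (hp : 1 <= p)
    (hY : forall N : nat, exists y : nat -> Y,
        (forall j, (1 <= j <= N)%nat -> C1 <= norm (y j)) /\
        forall a : nat -> K,
          norm (sum_n_m (fun j => scal (a j) (y j)) 1 N)
            <= C2 * rpow (sum_n_m (fun j => rpow (abs (a j)) p) 1 N) (/ p))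
    (X : 'I_m -> CompleteNormedModule K)
    (hX : forall k, infinite_dimensional (X k))
    (e : forall k, nat -> X k)
    (he : forall k, normalized (e k) /\ unconditional_basis (e k))
    (hqp : q < p)
    (hP : forall P : (forall k, X k) -> Y,
        as_summing n q P <-> continuous_multipoly n P) :
  Rbar_le (eta n e) q.
Proof.
(* [q] itself belongs to the set whose infimum is taken; by uniqueness of expansions the given
   coefficients are the coordinates. *)
apply: (proj1 (Glb_Rbar_correct _)); split=> // x a ha.
have hsum := monomial_summable hK hm hn hq hC1 hC2 hY he hqp
  (fun P => proj2 (hP P)) x.
apply: ex_series_ext hsum => j; congr (rpow (abs _) q).
apply: eq_bigr => k _; congr pow_n.
have [_ [hb _]] := he k.
by rewrite (@coord_unique K (X k) (e k) hb (x k) (a k)) //; apply/is_series_tends_to.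
Qed.
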